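(* Let $X,U$ be Hilbert spaces, let $A$ generate a strongly continuous semigroup $T(t)$ on $X$, let $B\in\mathcal{B}(U,X)$, let $F\in\mathcal{B}(X,U)$ be compact, and let the nonlinear operator $\phi:X\to X$ satisfy $\phi(0)=0$ and $\|\phi(\xi_1)-\phi(\xi_2)\|\le L\|\xi_1-\xi_2\|$ for all $\xi_1,\xi_2\in X$, for some Lipschitz constant $L\ge 0$. Assume that the semigroup $T_{BF}(t)$ generated by $A+BF$ is exponentially stable, i.e., $\|T_{BF}(t)\|_{\mathcal{B}(X)}\le \Gamma e^{-\gamma t}$ for all $t\ge 0$, for some $\Gamma\ge 1$ and $\gamma>0$. Then the following two statements hold. (a) For every $L\ge 0$ and $\varepsilon,\tau_{\max}>0$, there exists $\theta>0$ such that for every $x^0\in X$, the increasing sequence $\{t_k\}_{k\in\mathbb{N}_0}$ defined by the self-triggering mechanism (described in the context) satisfies $\inf_{k\in\mathbb{N}_0}(t_{k+1}-t_k)\ge\theta$. (b) The closed-loop system with the self-triggering mechanism is exponentially stable if $L\ge0$ and $\varepsilon,\tau_{\max}>0$ satisfy $$\max\left\{\frac{\Gamma}{\gamma}L,\ \varpi(L,\varepsilon,\tau_{\max})\right\}+\frac{\Gamma\|B\|_{\mathcal{B}(U,X)}}{\gamma}\,\varepsilon<1,$$ where $$\varpi(L,\varepsilon,\tau):=\frac{1}{e^{\gamma\tau}-1}\left(\left(1-\frac{\varepsilon\Gamma\|B\|_{\mathcal{B}(U,X)}}{\gamma}\right)(e^{\Gamma L\tau}-1)+\frac{\varepsilon\Gamma\|B\|_{\mathcal{B}(U,X)}}{\gamma}\,\frac{\Gamma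 L\,(e^{(\Gamma L+\gamma)\tau}-1)}{\Gamma L+\gamma}\right).$$
   Context: $\mathcal{B}(Y,Z)$ is the space of bounded linear operators from $Y$ to $Z$, $\mathcal{B}(X)=\mathcal{B}(X,X)$, $\mathbb{N}_0=\{0,1,2,\dots\}$, and $\|\cdot\|$ is the norm of $X$. Throughout, $L$ is the Lipschitz constant of $\phi$, and $\Gamma,\gamma$ are the constants in the bound on $T_{BF}(t)$. Closed-loop system: $\dot x(t)=Ax(t)+Bu(t)+\phi(x(t))$, $t\ge0$, $x(0)=x^0\in X$, with $u(t)=Fx(t_k)$ for $t_k\le t<t_{k+1}$, $k\in\mathbb{N}_0$. Its (mild) solution is the continuous $X$-valued function $x$ with $x(0)=x^0$ and $$x(t_k+\tau)=T(\tau)x(t_k)+\int_0^\tau T(\tau-s)\big(BFx(t_k)+\phi(x(t_k+s))\big)ds$$ for all $\tau\in(0,t_{k+1}-t_k]$ and all $k\in\mathbb{N}_0$. Exponential stability of the closed-loop system: there exist constants $\Gamma_0\ge1$ and $\gamma_0>0$ such that the solution satisfies $\|x(t)\|\le\Gamma_0e^{-\gamma_0t}\|x^0\|$ for all $x^0\in X$ and all $t\ge0$. Operators: $S_\tau:=\int_0^\tau T(s)B\,ds$ and $\Delta_\tau:=T(\tau)+S_\tau F$. Self-triggering mechanism, with threshold parameter $\varepsilon>0$ and upper bound $\tau_{\max}>0$ of inter-event times: put $$\eta_{L,\varepsilon}(\tau):=\Gamma e^{\Gamma L\tau}\big[(1-\varepsilon\|B\|_{\mathcal{B}(U,X)}/\gamma)e^{-\gamma\tau}+\varepsilon\|B\|_{\mathcal{B}(U,X)}/\gamma\big],\quad\tau\ge0,$$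 $$\alpha_{L,\varepsilon}(\xi,\tau):=\|F(I-\Delta_\tau)\xi\|_U+L\int_0^\tau\|FT(\tau-s)\|_{\mathcal{B}(X,U)}\,\eta_{L,\varepsilon}(s)\,ds\,\|\xi\|,\quad\xi\in X,\ \tau\ge0.$$ The transmission times are $$t_0:=0,\qquad t_{k+1}:=t_k+\min\{\tau_{\max},\tau_k\},\qquad \tau_k:=\inf\{\tau>0:\alpha_{L,\varepsilon}(x(t_k),\tau)\ge\varepsilon\|x(t_k)\|\},\quad k\in\mathbb{N}_0.$$
   Formalization: When x(t_k)=0 the literal rule gives τ_k=0 and t_{k+1}=t_k, so (a) fails, e.g. for x^0=0; the formal statement instead lets the zero state not trigger (τ_k=+∞, so t_{k+1}=t_k+τ_max); the rule is unchanged for x(t_k)≠0. *)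

(* Defs.v *)
From Stdlib Require Import Reals List.
From Coquelicot Require Export Coquelicot.

Open Scope R_scope.

(** * Hilbert spaces over the real or the complex field *)

Inductive scalar_field := RealField | ComplexField.

Definition scalars (k : scalar_field) : AbsRing :=
  match k with RealField => R_AbsRing | ComplexField => C_AbsRing end.

Definition of_real (k : scalar_field) : R -> scalars k :=
  match k with RealField => fun r => r | ComplexField => RtoC end.

Definition conj (k : scalar_field) : scalars k -> scalars k :=
  match k with RealField => fun z => z | ComplexField => Cconj end.

(* Coquelicot's norm on a [CompleteNormedModule] is the norm of the space;
   [inner_norm] says that it comes from the inner product. *)
Record Hilbert (k : scalar_field) := {
  hilbert_space :> CompleteNormedModule (scalars k);
  inner : hilbert_space -> hilbert_space -> scalars k;
  inner_plus_l : forall x y z,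
    inner (plus x y) z = plus (inner x z) (inner y z);
  inner_scal_l : forall a x y, inner (scal a x) y = mult a (inner x y);
  inner_conj : forall x y, inner y x = conj k (inner x y);
  inner_norm : forall x, inner x x = of_real k (norm x ^ 2)
}.

Arguments inner {k h} _ _.

(** * Restriction of scalars to the reals

    Coquelicot integrates functions with values in a real normed module.
    [realify V] has the points, addition, norm and uniform structure of [V]. *)

Lemma of_real_plus (k : scalar_field) (a b : R) :
  of_real k (a + b) = plus (of_real k a) (of_real k b).
Proof.
  destruct k; [reflexivity |].
  apply injective_projections; cbn; ring.
Qed.

Lemma of_real_mult (k : scalar_field) (a b : R) :
  of_real k (a * b) = mult (of_real k a) (of_real k b).
Proof.
  destruct k; [reflexivity |].
  apply injective_projections; cbn; ring.
Qed.

Lemma of_real_one (k : scalar_field) : of_real k 1 = one.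
Proof. destruct k; reflexivity. Qed.

Lemma of_real_abs (k : scalar_field) (a : R) : abs (of_real k a) = Rabs a.
Proof. destruct k; [reflexivity | apply Cmod_R]. Qed.

Section Realify.

Context {k : scalar_field} (V : CompleteNormedModule (scalars k)).

Definition real_scal (a : R) (v : V) : V := scal (of_real k a) v.

Lemma real_scal_assoc (a b : R) (v : V) :
  real_scal a (real_scal b v) = real_scal (a * b) v.
Proof. unfold real_scal. rewrite of_real_mult. exact (scal_assoc _ _ v). Qed.

Lemma real_scal_one (v : V) : real_scal 1 v = v.
Proof. unfold real_scal. rewrite of_real_one. exact (scal_one v). Qed.

Lemma real_scal_distr_l (a : R) (u v : V) :
  real_scal a (plus u v) = plus (real_scal a u) (real_scal a v).
Proof. exact (scal_distr_l (of_real k a) u v). Qed.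

Lemma real_scal_distr_r (a b : R) (v : V) :
  real_scal (a + b) v = plus (real_scal a v) (real_scal b v).
Proof. unfold real_scal. rewrite of_real_plus.
  exact (scal_distr_r (of_real k a) (of_real k b) v).
Qed.

Definition realify_module_mixin : ModuleSpace.mixin_of R_Ring V :=
  ModuleSpace.Mixin R_Ring V real_scal
    real_scal_assoc real_scal_one real_scal_distr_l real_scal_distr_r.

Definition realify_aux : NormedModuleAux R_AbsRing :=
  NormedModuleAux.Pack R_AbsRing V
    (NormedModuleAux.Class R_AbsRing V
       (ModuleSpace.Class R_Ring V
          (AbelianGroup.class (CompleteNormedModule.AbelianGroup _ V))
          realify_module_mixin)
       (UniformSpace.class (CompleteNormedModule.UniformSpace _ V))) V.

Lemma real_norm_scal (a : R) (v : V) :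
  norm (real_scal a v) <= Rabs a * norm v.
Proof.
  rewrite <- (of_real_abs k). apply (norm_scal (of_real k a) v).
Qed.

Definition realify_norm_mixin : NormedModule.mixin_of R_AbsRing realify_aux :=
  NormedModule.Mixin R_AbsRing realify_aux (@norm (scalars k) V)
    (@norm_factor (scalars k) V) (@norm_triangle (scalars k) V) real_norm_scal
    (@norm_compat1 (scalars k) V) (@norm_compat2 (scalars k) V)
    (@norm_eq_zero (scalars k) V).

Definition realify : CompleteNormedModule R_AbsRing :=
  CompleteNormedModule.Pack R_AbsRing V
    (CompleteNormedModule.Class R_AbsRing V
       (NormedModule.Class R_AbsRing V
          (NormedModuleAux.class R_AbsRing realify_aux) realify_norm_mixin)
       (CompleteNormedModule.mixin _ _
          (CompleteNormedModule.class (scalars k) V))) V.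

Definition integral (f : R -> V) (a b : R) : V := @RInt realify f a b.

End Realify.

Arguments integral {k V} f a b.

(** * Operators *)

(* Coquelicot's [is_linear] is "linear and bounded". *)
Definition op_norm {K : AbsRing} {V W : NormedModule K} (f : V -> W) : R :=
  real (Lub_Rbar (fun r => exists x : V, norm x <= 1 /\ r = norm (f x))).

Definition closure {V : UniformSpace} (S : V -> Prop) (x : V) : Prop :=
  forall O : V -> Prop, open O -> O x -> exists y, O y /\ S y.

Definition compact_set {V : UniformSpace} (S : V -> Prop) : Prop :=
  forall (I : Type) (O : I -> V -> Prop),
    (forall i, open (O i)) ->
    (forall x, S x -> exists i, O i x) ->
    exists l : list I, forall x, S x -> exists i, In i l /\ O i x.

Definition compact_operator {K : AbsRing} {V W : NormedModule K}
    (f : V -> W) : Prop :=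
  is_linear f /\
  compact_set (closure (fun y : W => exists x : V, norm x <= 1 /\ y = f x)).

(** * Strongly continuous semigroups *)

(* Only the values [T t] with [0 <= t] are meaningful. *)
Definition C0_semigroup {K : AbsRing} {V : NormedModule K}
    (T : R -> V -> V) : Prop :=
  (forall t, 0 <= t -> is_linear (T t)) /\
  (forall x, T 0 x = x) /\
  (forall s t, 0 <= s -> 0 <= t -> forall x, T (s + t) x = T s (T t x)) /\
  (forall x, filterlim (fun t => T t x) (at_right 0) (locally x)).

(* An unbounded operator is a domain [D] and a function [A] whose values
   outside [D] are irrelevant. *)
Definition generates {k : scalar_field} {V : CompleteNormedModule (scalars k)}
    (D : V -> Prop) (A : V -> V) (T : R -> V -> V) : Prop :=
  let right_derivative x y :=
    filterlim (fun h => scal (of_real k (/ h)) (minus (T h x) x))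
      (at_right 0) (locally y) in
  (forall x, D x -> right_derivative x (A x)) /\
  (forall x y, right_derivative x y -> D x).

(** * The sampled-data closed loop *)

(* Continuity is required on the union of the intervals [[0, t k]]: that is
   all of [[0, +oo)] unless the transmission times accumulate, in which case
   the equation says nothing beyond their limit. *)
Definition closed_loop_solution {k : scalar_field}
    {X U : CompleteNormedModule (scalars k)}
    (T : R -> X -> X) (B : U -> X) (F : X -> U) (phi : X -> X)
    (t : nat -> R) (x0 : X) (x : R -> X) : Prop :=
  x 0 = x0 /\
  continuous_on (fun s => 0 <= s /\ exists n, s <= t n) x /\
  forall n tau, 0 < tau <= t (S n) - t n ->
    x (t n + tau) =
    plus (T tau (x (t n)))
      (integral (fun s => T (tau - s)
                   (plus (B (F (x (t n)))) (phi (x (t n + s))))) 0 tau).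

Definition S_op {k : scalar_field} {X U : CompleteNormedModule (scalars k)}
    (T : R -> X -> X) (B : U -> X) (tau : R) (u : U) : X :=
  integral (fun s => T s (B u)) 0 tau.

Definition Delta {k : scalar_field} {X U : CompleteNormedModule (scalars k)}
    (T : R -> X -> X) (B : U -> X) (F : X -> U) (tau : R) (xi : X) : X :=
  plus (T tau xi) (S_op T B tau (F xi)).

(** * The self-triggering mechanism *)

(* In [eta] and [varpi], [b] stands for the operator norm of [B]. *)
Definition eta (Gamma gamma b L eps tau : R) : R :=
  Gamma * exp (Gamma * L * tau) *
  ((1 - eps * b / gamma) * exp (- gamma * tau) + eps * b / gamma).

Definition alpha {k : scalar_field} {X U : CompleteNormedModule (scalars k)}
    (T : R -> X -> X) (B : U -> X) (F : X -> U)
    (Gamma gamma L eps : R) (xi : X) (tau : R) : R :=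
  norm (F (minus xi (Delta T B F tau xi))) +
  L * RInt (fun s => op_norm (fun z => F (T (tau - s) z)) *
                     eta Gamma gamma (op_norm B) L eps s) 0 tau * norm xi.

(* Infimum in the extended reals, [p_infty] when no such [tau] exists.
   The state [zero] never triggers: for [xi = zero] both sides of the test
   vanish, so without [xi <> zero] the infimum would be 0 and time would stop. *)
Definition trigger_time {k : scalar_field} {X U : CompleteNormedModule (scalars k)}
    (T : R -> X -> X) (B : U -> X) (F : X -> U)
    (Gamma gamma L eps : R) (xi : X) : Rbar :=
  Glb_Rbar (fun tau => 0 < tau /\ xi <> zero /\
                       alpha T B F Gamma gamma L eps xi tau >= eps * norm xi).

Definition self_triggered_times {k : scalar_field}
    {X U : CompleteNormedModule (scalars k)}
    (T : R -> X -> X) (B : U -> X) (F : X -> U)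
    (Gamma gamma L eps tau_max : R) (x : R -> X) (t : nat -> R) : Prop :=
  t O = 0 /\
  forall n, Finite (t (S n)) =
    Rbar_plus (t n)
      (Rbar_min tau_max (trigger_time T B F Gamma gamma L eps (x (t n)))).

(* The transmission times and the state determine each other, so they are
   characterized jointly. *)
Definition self_triggered_solution {k : scalar_field}
    {X U : CompleteNormedModule (scalars k)}
    (T : R -> X -> X) (B : U -> X) (F : X -> U) (phi : X -> X)
    (Gamma gamma L eps tau_max : R)
    (x0 : X) (t : nat -> R) (x : R -> X) : Prop :=
  self_triggered_times T B F Gamma gamma L eps tau_max x t /\
  closed_loop_solution T B F phi t x0 x.

Definition exponentially_stable {K : AbsRing} {V : NormedModule K}
    (solution : V -> (R -> V) -> Prop) : Prop :=
  exists Gamma0 gamma0 : R, 1 <= Gamma0 /\ 0 < gamma0 /\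
    forall x0 x, solution x0 x ->
    forall s, 0 <= s -> norm (x s) <= Gamma0 * exp (- gamma0 * s) * norm x0.

Definition varpi (Gamma gamma b L eps tau : R) : R :=
  1 / (exp (gamma * tau) - 1) *
  ((1 - eps * Gamma * b / gamma) * (exp (Gamma * L * tau) - 1) +
   eps * Gamma * b / gamma *
   (Gamma * L * (exp ((Gamma * L + gamma) * tau) - 1) / (Gamma * L + gamma))).

(* Main.v *)
Require Import Defs.
From Stdlib Require Import Reals Lra Lia List Classical ClassicalEpsilon.
From Coquelicot Require Import Coquelicot.

Open Scope R_scope.

(** The idea of the proof. All spaces are regarded as real Hilbert spaces, with
    the real part of the inner product; norms, operator norms, integrals and
    generators are unchanged by this.

    Lower bound on the inter-event times. The triggering function [alpha] is at
    most a quantity tending to zero with [tau], times the norm of [xi], provided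
    that [F (T tau - I)] tends to zero in operator norm. This is where
    compactness and Hilbert structure enter. The adjoint semigroup is weakly
    continuous, and a weakly continuous semigroup is strongly continuous: the
    vectors with norm-continuous adjoint orbit form a closed subspace, which
    contains the averages of all adjoint orbits, and these averages converge
    weakly to their starting points; hence the subspace is everything
    ([adjoint_strongly_continuous], by orthogonal projection). Tested against a
    finite net of the image of the unit ball under the compact operator [F],
    this gives [compact_semigroup_norm_continuous], and then
    [real_alpha_small]. It also makes [t |-> op_norm (F T t)] continuous, so
    that the integral in [alpha] is a genuine Riemann integral.

    Stability. Write [S] for the stable semigroup [TBF]. Comparing [T] with [S]
    first on the domain of the generator and then, by density, everywhere
    ([perturbation_deriv]), a mild solution [y] of the closed loop on a sampling
    interval satisfies, to first order in [h],
    [y (s + h) = S h (y s) + h (B F (y 0 - y s) + phi (y s))]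
    ([mild_increment]). In the equivalent norm
    [N x = sup_s exp (gamma s) |S s x|] the semigroup [S] contracts at rate
    [gamma] with constant one, and the increments give a differential inequality
    for [N (y s)] with a one-sided derivative ([adapted_norm_dini]), from which
    explicit bounds follow by comparison ([dini_comparison]). A first comparison
    shows that [eta] dominates the state as long as the input error
    [F (y 0 - y s)] is below the threshold; then [alpha] dominates the error, and
    since [alpha] is below the threshold until the next transmission, a
    continuity argument keeps the error below it during the whole interval
    ([input_error_le_threshold]). A second comparison then yields
    [N (y s) <= exp (- gamma0 s) N (y 0)], for a small [gamma0 > 0] that exists
    because [Gamma L + Gamma |B| eps < gamma] ([interval_decay]). In the norm [N]
    this iterates over the sampling intervals without loss of constants, and the
    intervals exhaust the half-line because their lengths are bounded below. *)

(** * Equalities between linear combinations *)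

Inductive vexpr :=
  | VVar (n : nat)
  | VZero
  | VPlus (a b : vexpr)
  | VOpp (a : vexpr)
  | VScal (r : R) (a : vexpr).

Fixpoint vcoef (e : vexpr) (m : nat) : R :=
  match e with
  | VVar n => if Nat.eqb n m then 1 else 0
  | VZero => 0
  | VPlus a b => vcoef a m + vcoef b m
  | VOpp a => - vcoef a m
  | VScal r a => r * vcoef a m
  end.

Fixpoint coefs_eq (e f : vexpr) (m n : nat) : Prop :=
  match n with
  | O => True
  | S k => vcoef e m = vcoef f m /\ coefs_eq e f (S m) k
  end.

Section LinearCombinations.

Context {V : NormedModule R_AbsRing}.

Fixpoint veval (env : list V) (e : vexpr) : V :=
  match e with
  | VVar n => nth n env zero
  | VZero => zero
  | VPlus a b => plus (veval env a) (veval env b)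
  | VOpp a => opp (veval env a)
  | VScal r a => scal r (veval env a)
  end.

Fixpoint lincomb (c : nat -> R) (env : list V) (m : nat) : V :=
  match env with
  | nil => zero
  | x :: l => plus (scal (c m) x) (lincomb c l (S m))
  end.

Lemma plus_swap (a b c d : V) :
  plus (plus a b) (plus c d) = plus (plus a c) (plus b d).
Proof.
  rewrite <- !plus_assoc. f_equal. rewrite !plus_assoc. f_equal.
  apply plus_comm.
Qed.

Lemma lincomb_zero env m c : (forall n, (m <= n)%nat -> c n = 0) ->
  lincomb c env m = zero.
Proof.
  revert m; induction env as [|x l IH]; intros m Hc; simpl; [reflexivity|].
  rewrite IH by (intros; apply Hc; lia).
  rewrite (Hc m) by lia. rewrite plus_zero_r.
  exact (scal_zero_l x).
Qed.

Lemma lincomb_plus c d env m :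
  lincomb (fun n => c n + d n) env m = plus (lincomb c env m) (lincomb d env m).
Proof.
  revert m; induction env as [|x l IH]; intros m; simpl.
  - now rewrite plus_zero_r.
  - rewrite IH, plus_swap. f_equal. exact (scal_distr_r (c m) (d m) x).
Qed.

Lemma lincomb_scal r c env m :
  lincomb (fun n => r * c n) env m = scal r (lincomb c env m).
Proof.
  revert m; induction env as [|x l IH]; intros m; simpl.
  - symmetry. exact (scal_zero_r r).
  - rewrite IH, scal_distr_l. f_equal. symmetry. exact (scal_assoc r (c m) x).
Qed.

Lemma lincomb_var env m n :
  lincomb (fun i => if Nat.eqb (m + n) i then 1 else 0) env m = nth n env zero.
Proof.
  revert m n; induction env as [|x l IH]; intros m n; simpl; [now destruct n|].
  destruct n as [|n].
  - rewrite Nat.add_0_r, Nat.eqb_refl, lincomb_zero.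
    + rewrite plus_zero_r. exact (scal_one x).
    + intros i Hi. destruct (Nat.eqb_spec m i); [lia|reflexivity].
  - destruct (Nat.eqb_spec (m + S n) m); [lia|].
    replace (m + S n)%nat with (S m + n)%nat by lia.
    rewrite IH. transitivity (plus zero (nth n l zero)).
    + f_equal. exact (scal_zero_l x).
    + apply plus_zero_l.
Qed.

Lemma veval_lincomb env e : veval env e = lincomb (vcoef e) env 0.
Proof.
  induction e as [n| |a IHa b IHb|a IHa|r a IHa]; simpl.
  - symmetry. exact (lincomb_var env 0 n).
  - symmetry. now apply lincomb_zero.
  - now rewrite IHa, IHb, <- lincomb_plus.
  - rewrite IHa. transitivity (scal (-1) (lincomb (vcoef a) env 0)).
    { symmetry. exact (scal_opp_one (lincomb (vcoef a) env 0)). }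
    rewrite <- lincomb_scal. f_equal.
    apply FunctionalExtensionality.functional_extensionality.
    intros n. ring.
  - now rewrite IHa, <- lincomb_scal.
Qed.

(** Two linear combinations of the same vectors agree when the coefficients of
    each vector do; the tactic [vec_in] leaves these real equalities to [ring]
    and [field]. *)
Lemma veval_eq env e f : coefs_eq e f 0 (length env) ->
  veval env e = veval env f.
Proof.
  rewrite !veval_lincomb. generalize 0%nat as m.
  induction env as [|x l IH]; intros m; simpl; [reflexivity|].
  intros [H1 H2]. rewrite H1. f_equal. now apply IH.
Qed.

End LinearCombinations.

Ltac vec_index x env :=
  lazymatch env with
  | cons x _ => constr:(O)
  | cons _ ?l => let n := vec_index x l in constr:(S n)
  end.

Ltac vec_add x env :=
  lazymatch env with
  | context [cons x _] => env
  | _ => constr:(cons x env)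
  end.

Ltac vec_env t env :=
  lazymatch t with
  | plus ?a ?b => let e := vec_env a env in vec_env b e
  | minus ?a ?b => let e := vec_env a env in vec_env b e
  | opp ?a => vec_env a env
  | scal _ ?a => vec_env a env
  | zero => env
  | _ => vec_add t env
  end.

Ltac vec_reify t env :=
  lazymatch t with
  | plus ?a ?b =>
      let x := vec_reify a env in let y := vec_reify b env in constr:(VPlus x y)
  | minus ?a ?b =>
      let x := vec_reify a env in let y := vec_reify b env in
      constr:(VPlus x (VOpp y))
  | opp ?a => let x := vec_reify a env in constr:(VOpp x)
  | scal ?r ?a => let x := vec_reify a env in constr:(VScal r x)
  | zero => constr:(VZero)
  | _ => let n := vec_index t env in constr:(VVar n)
  end.

Ltac vec_in V :=
  lazymatch goal with
  | |- @eq _ ?a ?b =>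
    let env := vec_env a (@nil (NormedModule.sort R_AbsRing V)) in
    let env := vec_env b env in
    let x := vec_reify a env in
    let y := vec_reify b env in
    change (@veval V env x = @veval V env y);
    apply veval_eq; cbv [coefs_eq vcoef Nat.eqb length]; repeat split;
    try ring; try (field; lra)
  end.

(** The same sum can be elaborated through different inheritance paths of the
    algebraic structures of [V]; [canon V] chooses one of them, for the sake of
    tactics that compare terms syntactically. *)
Ltac canon V :=
  let G := constr:(CompleteNormedModule.AbelianMonoid R_AbsRing V) in
  repeat match goal with
  | |- context [@plus ?H] =>
      tryif constr_eq H G then fail else change (@plus H) with (@plus G)
  | h : context [@plus ?H] |- _ =>
      tryif constr_eq H G then fail else change (@plus H) with (@plus G) in h
  end.

(** * Differential inequalities with one-sided derivatives *)

(** The least upper bound of the times up to which [P] holds can neither be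
    left out, by the closure hypothesis, nor be smaller than [a], by the
    extension hypothesis. *)
Lemma real_induction (P : R -> Prop) (a : R) :
  0 <= a -> P 0 ->
  (forall s, 0 <= s < a -> (forall r, 0 <= r <= s -> P r) ->
     exists d, 0 < d /\ forall r, s < r < s + d -> r <= a -> P r) ->
  (forall s, 0 < s <= a -> (forall r, 0 <= r < s -> P r) -> P s) ->
  forall s, 0 <= s <= a -> P s.
Proof.
  intros Ha H0 Hstep Hlim.
  set (E := fun s => 0 <= s <= a /\ forall r, 0 <= r <= s -> P r).
  destruct (completeness E) as [m [Hub Hlub]].
  - exists a. intros s [Hs _]. lra.
  - exists 0. split; [lra|]. intros r Hr. now replace r with 0 by lra.
  - assert (Hm0 : 0 <= m).
    { apply Hub. split; [lra|]. intros r Hr. now replace r with 0 by lra. }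
    assert (Hma : m <= a) by (apply Hlub; intros s [Hs _]; lra).
    assert (Hbelow : forall r, 0 <= r < m -> P r).
    { intros r Hr. apply NNPP. intros Hn.
      assert (m <= r); [|lra].
      apply Hlub. intros s [Hs HP]. apply Rnot_lt_le. intros Hrs.
      apply Hn, HP. lra. }
    assert (Hat : forall r, 0 <= r <= m -> P r).
    { intros r Hr. destruct (Req_dec r m) as [->|Hne]; [|apply Hbelow; lra].
      destruct (Req_dec m 0) as [->|Hm]; [assumption|].
      apply Hlim; [lra|assumption]. }
    destruct (Rlt_le_dec m a) as [Hlt|Hge].
    + exfalso. destruct (Hstep m) as [d [Hd HP]]; [lra|assumption|].
      set (s := Rmin a (m + d / 2)).
      assert (Hs : s <= a /\ s <= m + d / 2 /\ m < s).
      { unfold s. repeat split; [apply Rmin_l|apply Rmin_r|].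
        apply Rmin_glb_lt; lra. }
      assert (s <= m); [|lra].
      apply Hub. split; [lra|]. intros r Hr.
      destruct (Rle_lt_dec r m); [apply Hat; lra|apply HP; lra].
    + intros s Hs. apply Hat. lra.
Qed.

(** The upper right Dini derivative of [f] at [s] is at most [c]. *)
Definition dini_le (f : R -> R) (s c : R) : Prop :=
  forall e, 0 < e -> exists d, 0 < d /\
    forall h, 0 < h < d -> f (s + h) <= f s + h * (c + e).

Definition cont_at (f : R -> R) (s : R) : Prop :=
  forall e, 0 < e -> exists d, 0 < d /\
    forall r, Rabs (r - s) < d -> Rabs (f r - f s) < e.

Lemma continuity_cont_at f s : continuity_pt f s -> cont_at f s.
Proof.
  intros H e He. destruct (H e He) as [d [Hd Hf]]. exists d. split; [easy|].
  intros r Hr. destruct (Req_dec s r) as [->|Hne].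
  - rewrite Rminus_diag, Rabs_R0. lra.
  - apply (Hf r). split; [split; [exact I|easy]|exact Hr].
Qed.

(** The strict version is a first-exit argument: at a first touching time the
    Dini derivative of [f] is below the derivative of [v]. Adding
    [d * exp ((kappa + 1) s)] to [v] makes the inequality for [v] strict. *)
Lemma dini_comparison (f v dv : R -> R) (kappa c a : R) :
  0 <= a ->
  (forall s, 0 <= s <= a -> cont_at f s) ->
  (forall s, is_derive v s (dv s)) ->
  f 0 <= v 0 ->
  (forall s, 0 <= s < a -> dini_le f s (kappa * f s + c)) ->
  (forall s, 0 <= s < a -> kappa * v s + c <= dv s) ->
  forall s, 0 <= s <= a -> f s <= v s.
Proof.
  intros Ha Hcont Hder H0 Hf Hv.
  assert (Hstrict : forall d, 0 < d ->
    forall s, 0 <= s <= a -> f s <= v s + d * exp ((kappa + 1) * s)).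
  { intros d Hd.
    set (w := fun s => v s + d * exp ((kappa + 1) * s)).
    set (dw := fun s => dv s + d * ((kappa + 1) * exp ((kappa + 1) * s))).
    assert (Hdw : forall s, is_derive w s (dw s)).
    { intros s. unfold w, dw. apply (is_derive_plus v (fun s => d * exp ((kappa + 1) * s))); [apply Hder|].
      auto_derive; [easy|ring]. }
    assert (Hcw : forall s, cont_at w s).
    { intros s. apply continuity_cont_at, derivable_continuous_pt.
      exists (dw s). apply is_derive_Reals, Hdw. }
    change (forall s, 0 <= s <= a -> f s <= w s).
    apply real_induction; [assumption| | |].
    - unfold w. rewrite Rmult_0_r, exp_0. lra.
    - intros s Hs HP. specialize (HP s ltac:(lra)).
      destruct (Req_dec (f s) (w s)) as [Heq|Hne].
      + assert (Hgap : kappa * f s + c + d * exp ((kappa + 1) * s) <= dw s).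
        { rewrite Heq. unfold w, dw. specialize (Hv s Hs). lra. }
        pose proof (exp_pos ((kappa + 1) * s)) as Hexp.
        set (e := d * exp ((kappa + 1) * s) / 3).
        assert (He : 0 < e) by (unfold e; apply Rdiv_lt_0_compat; nra).
        destruct (Hf s Hs e He) as [d1 [Hd1 Hf1]].
        assert (Hw1 := Hdw s). apply is_derive_Reals in Hw1.
        destruct (Hw1 e He) as [[d2 Hd2] Hw2]. simpl in Hw2.
        exists (Rmin d1 d2). split; [now apply Rmin_pos|].
        intros r Hr _.
        pose proof (Rmin_l d1 d2). pose proof (Rmin_r d1 d2).
        specialize (Hf1 (r - s) ltac:(lra)).
        specialize (Hw2 (r - s) ltac:(lra)).
        replace (s + (r - s)) with r in * by ring.
        assert (Hq : Rabs ((w r - w s) / (r - s) - dw s) < e).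
        { apply Hw2. rewrite Rabs_right; lra. }
        apply Rabs_def2 in Hq. destruct Hq as [_ Hq].
        assert (Hq2 : (r - s) * (dw s - e) <= w r - w s).
        { replace (w r - w s) with ((r - s) * ((w r - w s) / (r - s)))
            by (field; lra).
          apply Rmult_le_compat_l; lra. }
        assert (Hslope : kappa * f s + c + e <= dw s - e)
          by (unfold e in *; lra).
        assert ((r - s) * (kappa * f s + c + e) <= (r - s) * (dw s - e))
          by (apply Rmult_le_compat_l; lra).
        lra.
      + set (e := (w s - f s) / 2). assert (He : 0 < e) by (unfold e; lra).
        destruct (Hcont s ltac:(lra) e He) as [d1 [Hd1 Hf1]].
        destruct (Hcw s e He) as [d2 [Hd2 Hw2]].
        exists (Rmin d1 d2). split; [now apply Rmin_pos|].
        intros r Hr _.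
        pose proof (Rmin_l d1 d2). pose proof (Rmin_r d1 d2).
        assert (Hrs : Rabs (r - s) = r - s) by (apply Rabs_right; lra).
        specialize (Hf1 r ltac:(lra)). specialize (Hw2 r ltac:(lra)).
        apply Rabs_def2 in Hf1, Hw2. unfold e in *. lra.
    - intros s Hs HP. apply Rnot_lt_le. intros Hlt.
      set (e := (f s - w s) / 2). assert (He : 0 < e) by (unfold e; lra).
      destruct (Hcont s ltac:(lra) e He) as [d1 [Hd1 Hf1]].
      destruct (Hcw s e He) as [d2 [Hd2 Hw2]].
      set (h := Rmin s (Rmin d1 d2) / 2).
      assert (Hh : 0 < h /\ h <= s / 2 /\ h <= d1 / 2 /\ h <= d2 / 2).
      { pose proof (Rmin_l s (Rmin d1 d2)). pose proof (Rmin_r s (Rmin d1 d2)).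
        pose proof (Rmin_l d1 d2). pose proof (Rmin_r d1 d2).
        assert (0 < Rmin s (Rmin d1 d2)) by (repeat apply Rmin_pos; lra).
        unfold h. lra. }
      assert (Hrs : Rabs (s - h - s) = h)
        by (replace (s - h - s) with (- h) by ring;
            rewrite Rabs_Ropp; apply Rabs_right; lra).
      specialize (Hf1 (s - h) ltac:(lra)). specialize (Hw2 (s - h) ltac:(lra)).
      specialize (HP (s - h) ltac:(lra)).
      apply Rabs_def2 in Hf1, Hw2. unfold e in *. lra. }
  intros s Hs. apply Rnot_lt_le. intros Hlt.
  pose proof (exp_pos ((kappa + 1) * s)) as Hexp.
  set (d := (f s - v s) / (2 * exp ((kappa + 1) * s))).
  assert (Hd : 0 < d) by (apply Rdiv_lt_0_compat; lra).
  specialize (Hstrict d Hd s Hs).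
  replace (d * exp ((kappa + 1) * s)) with ((f s - v s) / 2) in Hstrict
    by (unfold d; field; lra).
  lra.
Qed.

(** * Norms of vectors and operators *)

Section Norms.

Context {V : CompleteNormedModule R_AbsRing}.

Lemma norm_0 : norm (zero : V) = 0.
Proof. exact (@norm_zero R_AbsRing V). Qed.

Lemma norm_neg (x : V) : norm (opp x) = norm x.
Proof. exact (norm_opp x). Qed.

Lemma norm_plus_le (x y : V) : norm (plus x y) <= norm x + norm y.
Proof. exact (norm_triangle x y). Qed.

Lemma norm_scal_eq (r : R) (x : V) : norm (scal r x) = Rabs r * norm x.
Proof.
  apply Rle_antisym; [exact (norm_scal r x)|].
  destruct (Req_dec r 0) as [->|Hr].
  { rewrite Rabs_R0, Rmult_0_l. apply norm_ge_0. }
  replace (norm x) with (norm (scal (/ r) (scal r x))) by (f_equal; vec_in V).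
  pose proof (norm_scal (/ r) (scal r x)) as H.
  change (abs (/ r)) with (Rabs (/ r)) in H. rewrite Rabs_inv in H.
  pose proof (Rabs_pos_lt r Hr) as Hpos.
  apply (Rmult_le_compat_l (Rabs r)) in H; [|lra].
  replace (Rabs r * (/ Rabs r * norm (scal r x))) with (norm (scal r x)) in H
    by (field; lra).
  exact H.
Qed.

Lemma norm_scal_pos (r : R) (x : V) : 0 <= r ->
  norm (scal r x) = r * norm x.
Proof. intros Hr. rewrite norm_scal_eq, Rabs_right; lra. Qed.

Lemma norm_minus_triangle (a b c : V) :
  norm (minus a c) <= norm (minus a b) + norm (minus b c).
Proof.
  replace (minus a c) with (plus (minus a b) (minus b c)) by vec_in V.
  apply norm_plus_le.
Qed.

Lemma norm_minus_sym (a b : V) : norm (minus a b) = norm (minus b a).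
Proof. rewrite <- (norm_neg (minus a b)). f_equal. vec_in V. Qed.

Lemma norm_minus_self (a : V) : norm (minus a a) = 0.
Proof. replace (minus a a) with (zero : V) by vec_in V. apply norm_0. Qed.

Lemma norm_le_minus (a b : V) : norm a <= norm b + norm (minus a b).
Proof.
  replace a with (plus b (minus a b)) at 1 by vec_in V. apply norm_plus_le.
Qed.

Lemma norm_minus_le (a b : V) : norm (minus a b) <= norm a + norm b.
Proof. rewrite <- (norm_neg b). apply norm_plus_le. Qed.

Lemma norm_split_plus (u a b : V) : u = plus a b -> norm u <= norm a + norm b.
Proof. intros ->. apply norm_plus_le. Qed.

Lemma norm_split_minus (u a b : V) :
  u = minus a b -> norm u <= norm a + norm b.
Proof. intros ->. apply norm_minus_le. Qed.

Lemma continuous_norm_iff (f : R -> V) (s : R) :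
  continuous f s <->
  forall e, 0 < e -> exists d, 0 < d /\
    forall r, Rabs (r - s) < d -> norm (minus (f r) (f s)) < e.
Proof.
  pose proof (filterlim_locally_ball_norm (F := locally s) f (f s)) as Hiff.
  split.
  - intros Hf e He. pose proof (proj1 Hiff Hf) as H. destruct (H (mkposreal e He)) as [d Hd].
    exists d. split; [apply cond_pos|]. intros r Hr. exact (Hd r Hr).
  - intros H. apply (proj2 Hiff). intros e. destruct (H e (cond_pos e)) as [d [Hd Hf]].
    exists (mkposreal d Hd). intros r Hr. exact (Hf r Hr).
Qed.

Lemma cont_at_norm (f : R -> V) (N : V -> R) (C s : R) :
  (forall x y : V, Rabs (N x - N y) <= C * norm (minus x y)) ->
  continuous f s -> cont_at (fun r => N (f r)) s.
Proof.
  intros HN Hf e He. rewrite continuous_norm_iff in Hf.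
  destruct (Hf (e / (Rabs C + 1))) as [d [Hd Hr]].
  { apply Rdiv_lt_0_compat; [lra|]. pose proof (Rabs_pos C). lra. }
  exists d. split; [lra|]. intros r Hrd. specialize (Hr r Hrd).
  apply Rle_lt_trans with (1 := HN _ _).
  pose proof (Rabs_pos C). pose proof (Rle_abs C).
  pose proof (norm_ge_0 (minus (f r) (f s))).
  apply (Rmult_lt_compat_r (Rabs C + 1)) in Hr; [|lra].
  replace (e / (Rabs C + 1) * (Rabs C + 1)) with e in Hr by (field; lra).
  nra.
Qed.

Lemma norm_lipschitz (z x y : V) :
  Rabs (norm (minus x z) - norm (minus y z)) <= 1 * norm (minus x y).
Proof.
  apply Rle_trans with (1 := norm_triangle_inv (minus x z) (minus y z)).
  right. rewrite Rmult_1_l. f_equal. vec_in V.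
Qed.

End Norms.

Section OperatorNorm.

Context {V W : CompleteNormedModule R_AbsRing}.

Lemma lin_plus (f : V -> W) (x y : V) : is_linear f ->
  f (plus x y) = plus (f x) (f y).
Proof. intros Hf. exact (linear_plus f Hf x y). Qed.

Lemma lin_minus (f : V -> W) (x y : V) : is_linear f ->
  f (minus x y) = minus (f x) (f y).
Proof. intros Hf. exact (linear_minus f x y Hf). Qed.

Lemma lin_scal (f : V -> W) (r : R) (x : V) : is_linear f ->
  f (scal r x) = scal r (f x).
Proof. intros Hf. exact (linear_scal f Hf r x). Qed.

Lemma lin_zero (f : V -> W) : is_linear f -> f zero = zero.
Proof. intros Hf. exact (linear_zero f Hf). Qed.

Lemma op_norm_lub (f : V -> W) : is_linear f ->
  is_lub_Rbar (fun r => exists x : V, norm x <= 1 /\ r = norm (f x))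
    (Finite (op_norm f)).
Proof.
  intros Hf.
  set (E := fun r => exists x : V, norm x <= 1 /\ r = norm (f x)).
  change (is_lub_Rbar E (Finite (real (Lub_Rbar E)))).
  pose proof (Lub_Rbar_correct E) as HL.
  destruct (linear_norm f Hf) as [M [HM Hb]].
  destruct (Lub_Rbar E) as [l| |]; [exact HL| |].
  - exfalso. destruct HL as [_ HL]. specialize (HL (Finite M)). apply HL.
    intros r [x [Hx ->]]. simpl. specialize (Hb x). nra.
  - exfalso. destruct HL as [HL _]. apply (HL (norm (f zero))).
    exists zero. split; [|reflexivity]. rewrite norm_0. lra.
Qed.

Lemma op_norm_ge0 (f : V -> W) : is_linear f -> 0 <= op_norm f.
Proof.
  intros Hf. destruct (op_norm_lub f Hf) as [Hub _].
  apply Rle_trans with (1 := norm_ge_0 (f zero)).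
  apply (Hub (norm (f zero))). exists zero.
  split; [|reflexivity]. rewrite norm_0. lra.
Qed.

Lemma op_norm_bound (f : V -> W) (x : V) : is_linear f ->
  norm (f x) <= op_norm f * norm x.
Proof.
  intros Hf. destruct (op_norm_lub f Hf) as [Hub _].
  destruct (Req_dec (norm x) 0) as [Hx|Hx].
  - rewrite Hx, Rmult_0_r. apply norm_eq_zero in Hx. subst x.
    rewrite lin_zero by assumption. rewrite norm_0. lra.
  - pose proof (norm_ge_0 x) as Hx0.
    assert (Hu : norm (f (scal (/ norm x) x)) <= op_norm f).
    { apply (Hub (norm (f (scal (/ norm x) x)))).
      exists (scal (/ norm x) x). split; [|reflexivity].
      rewrite norm_scal_pos by (apply Rlt_le, Rinv_0_lt_compat; lra).
      right. field. assumption. }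
    rewrite lin_scal in Hu by assumption. rewrite norm_scal_pos in Hu
      by (apply Rlt_le, Rinv_0_lt_compat; lra).
    apply (Rmult_le_compat_r (norm x)) in Hu; [|lra].
    replace (/ norm x * norm (f x) * norm x) with (norm (f x)) in Hu
      by (field; assumption).
    exact Hu.
Qed.

Lemma op_norm_le (f : V -> W) (M : R) : is_linear f -> 0 <= M ->
  (forall x : V, norm (f x) <= M * norm x) -> op_norm f <= M.
Proof.
  intros Hf HM Hb. destruct (op_norm_lub f Hf) as [_ Hlub].
  apply (Hlub (Finite M)). intros r [x [Hx ->]]. simpl.
  specialize (Hb x). nra.
Qed.

Lemma op_norm_approx (f : V -> W) (r : R) : is_linear f -> r < op_norm f ->
  exists x : V, norm x <= 1 /\ r < norm (f x).
Proof.
  intros Hf Hr. destruct (op_norm_lub f Hf) as [_ Hlub].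
  apply NNPP. intros Hn. assert (op_norm f <= r); [|lra].
  apply (Hlub (Finite r)). intros q [x [Hx ->]]. simpl.
  apply Rnot_lt_le. intros Hlt. apply Hn. now exists x.
Qed.

Lemma op_norm_lipschitz (f g : V -> W) (M : R) : is_linear f -> is_linear g ->
  0 <= M -> (forall x : V, norm (minus (f x) (g x)) <= M * norm x) ->
  Rabs (op_norm f - op_norm g) <= M.
Proof.
  intros Hf Hg HM Hb.
  pose proof (op_norm_ge0 f Hf). pose proof (op_norm_ge0 g Hg).
  assert (op_norm f <= op_norm g + M).
  { apply op_norm_le; [assumption|lra|]. intros x.
    apply Rle_trans with (1 := norm_le_minus (f x) (g x)).
    pose proof (op_norm_bound g x Hg). specialize (Hb x). lra. }
  assert (op_norm g <= op_norm f + M).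
  { apply op_norm_le; [assumption|lra|]. intros x.
    apply Rle_trans with (1 := norm_le_minus (g x) (f x)).
    rewrite norm_minus_sym.
    pose proof (op_norm_bound f x Hf). specialize (Hb x). lra. }
  apply Rabs_le. lra.
Qed.

End OperatorNorm.

(** * The uniform boundedness principle *)

Lemma geometric_third (n : nat) : 0 < (/ 3) ^ n.
Proof. apply pow_lt. lra. Qed.

Lemma seq_limit {V : CompleteNormedModule R_AbsRing} (x : nat -> V) :
  (forall n, norm (minus (x (S n)) (x n)) <= (/ 3) ^ S n) ->
  exists l : V, forall n, norm (minus l (x n)) <= / 2 * (/ 3) ^ n.
Proof.
  intros Hx.
  assert (Hdist : forall n m, norm (minus (x (n + m)%nat) (x n))
                       <= / 2 * (/ 3) ^ n - / 2 * (/ 3) ^ (n + m)).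
  { intros n m. induction m as [|m IH].
    - rewrite Nat.add_0_r. rewrite norm_minus_self. lra.
    - apply Rle_trans with (1 := norm_minus_triangle _ (x (n + m)%nat) _).
      rewrite Nat.add_succ_r. specialize (Hx (n + m)%nat).
      simpl pow in *. lra. }
  assert (Hsmall : forall e, 0 < e -> exists n, (/ 3) ^ n < e).
  { intros e He. destruct (pow_lt_1_zero (/ 3)) with (y := e) as [n Hn];
      [rewrite Rabs_right; lra|assumption|].
    exists n. specialize (Hn n (Nat.le_refl n)).
    rewrite Rabs_right in Hn; [easy|]. apply Rle_ge, Rlt_le, geometric_third. }
  destruct (proj1 (filterlim_locally_cauchy (F := eventually) x)) as [l Hl].
  { intros e. destruct (Hsmall e (cond_pos e)) as [n Hn].
    exists (fun m => (n <= m)%nat). split; [now exists n|].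
    assert (Hnm : forall m, (n <= m)%nat ->
              norm (minus (x m) (x n)) <= / 2 * (/ 3) ^ n).
    { intros m Hm. specialize (Hdist n (m - n)%nat).
      replace (n + (m - n))%nat with m in Hdist by lia.
      pose proof (geometric_third m). lra. }
    intros u v Hu Hv. apply (@norm_compat1 R_AbsRing V).
    apply Rle_lt_trans with (1 := norm_minus_triangle _ (x n) _).
    rewrite (norm_minus_sym (x n)). specialize (Hnm u Hu) as H1.
    specialize (Hnm v Hv). lra. }
  exists l. intros n. apply le_epsilon. intros e He.
  pose proof (proj1 (filterlim_locally_ball_norm (F := eventually) x l) Hl)
    as Hl'.
  destruct (Hl' (mkposreal e He)) as [N HN].
  specialize (HN (n + N)%nat ltac:(lia)). 
  change (norm (minus (x (n + N)%nat) l) < e) in HN.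
  apply Rle_trans with (1 := norm_minus_triangle _ (x (n + N)%nat) _).
  rewrite norm_minus_sym. specialize (Hdist n N).
  pose proof (geometric_third (n + N)). lra.
Qed.

(** Sokal's gliding hump: since [2 A z = A (x + z) - A (x - z)], a ball of
    radius [r] around any [x] contains a point where [A] is at least
    [r * op_norm A] up to a factor. Moving by steps [3 ^ (- n)] towards such
    points for operators of norm at least [4 ^ n] yields a limit where the
    family is unbounded. *)
Lemma uniform_boundedness {V W : CompleteNormedModule R_AbsRing} (I : Type)
    (A : I -> V -> W) :
  (forall i, is_linear (A i)) ->
  (forall x : V, exists C, forall i, norm (A i x) <= C) ->
  exists M, forall i (x : V), norm (A i x) <= M * norm x.
Proof.
  intros Hlin Hpt. apply NNPP. intros Hunb.
  assert (Hbig : forall n : nat, exists i, 4 ^ n < op_norm (A i)).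
  { intros n. apply NNPP. intros Hn. apply Hunb. exists (4 ^ n).
    intros i x. apply Rle_trans with (1 := op_norm_bound (A i) x (Hlin i)).
    apply Rmult_le_compat_r; [apply norm_ge_0|].
    apply Rnot_lt_le. intros Hlt. apply Hn. now exists i. }
  assert (Hstep : forall p : nat * V, exists q : V,
    norm (minus q (snd p)) <= (/ 3) ^ S (fst p) /\
    exists i, 4 ^ S (fst p) < op_norm (A i) /\
      2 / 3 * (/ 3) ^ S (fst p) * op_norm (A i) <= norm (A i q)).
  { intros [n x]. simpl fst. simpl snd. destruct (Hbig (S n)) as [i Hi].
    set (r := (/ 3) ^ S n). assert (Hr : 0 < r) by apply geometric_third.
    assert (H4 : 0 < 4 ^ S n) by (apply pow_lt; lra).
    destruct (op_norm_approx (A i) (2 / 3 * op_norm (A i)) (Hlin i))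
      as [z [Hz HAz]]; [lra|].
    set (xp := plus x (scal r z)). set (xm := minus x (scal r z)).
    assert (Hrz : norm (scal r z) <= r).
    { rewrite norm_scal_pos by lra. nra. }
    assert (H2 : 2 * r * norm (A i z) <= norm (A i xp) + norm (A i xm)).
    { apply Rle_trans with (2 := norm_minus_le (A i xp) (A i xm)).
      rewrite <- (lin_minus (A i) _ _ (Hlin i)).
      replace (minus xp xm) with (scal (2 * r) z) by (unfold xp, xm; vec_in V).
      rewrite (lin_scal _ _ _ (Hlin i)), norm_scal_pos; lra. }
    destruct (Rle_lt_dec (norm (A i xm)) (norm (A i xp))).
    - exists xp. split.
      + replace (minus xp x) with (scal r z) by (unfold xp; vec_in V). exact Hrz.
      + exists i. split; [assumption|]. nra.
    - exists xm. split.
      + replace (minus xm x) with (opp (scal r z)) by (unfold xm; vec_in V).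
        apply Rle_trans with (2 := Hrz). right. apply norm_neg.
      + exists i. split; [assumption|]. nra. }
  destruct (Hbig O) as [i0 _].
  set (next := fun p => proj1_sig
    (constructive_indefinite_description _ (Hstep p))).
  assert (Hnext : forall p, norm (minus (next p) (snd p)) <= (/ 3) ^ S (fst p) /\
    exists i, 4 ^ S (fst p) < op_norm (A i) /\
      2 / 3 * (/ 3) ^ S (fst p) * op_norm (A i) <= norm (A i (next p))).
  { intros p. unfold next. apply proj2_sig. }
  set (x := fix x n := match n with O => zero | S n => next (n, x n) end).
  destruct (seq_limit x) as [l Hl].
  { intros n. apply (Hnext (n, x n)). }
  destruct (Hpt l) as [C HC].
  assert (Hgrow : forall n, / 6 * (4 / 3) ^ S n <= C).
  { intros n. destruct (Hnext (n, x n)) as [_ [i [Hi Hq]]].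
    change (next (n, x n)) with (x (S n)) in Hq. simpl fst in *.
    specialize (HC i). specialize (Hl (S n)).
    pose proof (norm_le_minus (A i (x (S n))) (A i l)) as Hd.
    rewrite norm_minus_sym in Hd.
    rewrite <- (lin_minus (A i) _ _ (Hlin i)) in Hd.
    pose proof (op_norm_bound (A i) (minus l (x (S n))) (Hlin i)) as Hb.
    pose proof (geometric_third (S n)) as Hr.
    assert (H4 : 0 < 4 ^ S n) by (apply pow_lt; lra).
    replace ((4 / 3) ^ S n) with (4 ^ S n * (/ 3) ^ S n)
      by (rewrite <- Rpow_mult_distr; f_equal; lra).
    set (r := (/ 3) ^ S n) in *. set (q := 4 ^ S n) in *.
    assert (op_norm (A i) * norm (minus l (x (S n)))
            <= op_norm (A i) * (/ 2 * r)) by (apply Rmult_le_compat_l; lra).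
    nra. }
  destruct (Pow_x_infinity (4 / 3)) with (b := 6 * C + 1) as [N HN];
    [rewrite Rabs_right; lra|].
  specialize (HN (S N) ltac:(lia)). specialize (Hgrow N).
  rewrite Rabs_right in HN; [lra|]. apply Rle_ge, pow_le. lra.
Qed.

(** * Integrals of vector-valued functions *)

Section Integrals.

Context {V W : CompleteNormedModule R_AbsRing}.

Lemma Riemann_sum_linear (l : V -> W) (f : R -> V) (ptd : SF_seq) :
  is_linear l -> Riemann_sum (fun s => l (f s)) ptd = l (Riemann_sum f ptd).
Proof.
  intros Hl. pattern ptd. apply SF_cons_ind; clear ptd.
  - intros x0. symmetry. exact (lin_zero l Hl).
  - intros h ptd IH. rewrite !Riemann_sum_cons, IH.
    etransitivity; [|symmetry; exact (lin_plus l _ _ Hl)].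
    f_equal. symmetry. exact (lin_scal l _ _ Hl).
Qed.

Lemma is_RInt_linear (l : V -> W) (f : R -> V) (a b : R) (I : V) :
  is_linear l -> is_RInt f a b I -> is_RInt (fun s => l (f s)) a b (l I).
Proof.
  intros Hl Hf. unfold is_RInt in *.
  apply filterlim_ext
    with (f := fun ptd => l (scal (sign (b - a)) (Riemann_sum f ptd))).
  - intros ptd. etransitivity; [exact (lin_scal l _ _ Hl)|].
    f_equal. symmetry. now apply Riemann_sum_linear.
  - eapply filterlim_comp; [exact Hf|]. exact (linear_cont l I Hl).
Qed.

Lemma ex_RInt_linear (l : V -> W) (f : R -> V) (a b : R) :
  is_linear l -> ex_RInt f a b -> ex_RInt (fun s => l (f s)) a b.
Proof. intros Hl [I HI]. exists (l I). now apply is_RInt_linear. Qed.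

Lemma RInt_linear (l : V -> W) (f : R -> V) (a b : R) :
  is_linear l -> ex_RInt f a b ->
  RInt (fun s => l (f s)) a b = l (RInt f a b).
Proof.
  intros Hl Hf. apply is_RInt_unique, is_RInt_linear; [assumption|].
  now apply RInt_correct.
Qed.

Lemma norm_RInt_bound (f : R -> V) (a b M : R) :
  a <= b -> ex_RInt f a b -> (forall s, a <= s <= b -> norm (f s) <= M) ->
  norm (RInt f a b) <= (b - a) * M.
Proof.
  intros Hab Hf HM.
  exact (norm_RInt_le_const f a b _ M Hab HM (RInt_correct f a b Hf)).
Qed.

Lemma RInt_near (f : R -> V) (c : V) (h e : R) :
  0 <= h -> ex_RInt f 0 h ->
  (forall s, 0 <= s <= h -> norm (minus (f s) c) <= e) ->
  norm (minus (RInt f 0 h) (scal h c)) <= h * e.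
Proof.
  intros Hh Hf Hc.
  replace (scal h c) with (RInt (fun _ : R => c) 0 h).
  2:{ rewrite RInt_const. f_equal. ring. }
  rewrite <- (RInt_minus f (fun _ => c)) by (try assumption; apply ex_RInt_const).
  replace (h * e) with ((h - 0) * e) by ring.
  apply norm_RInt_bound; [assumption| |assumption].
  apply (ex_RInt_minus f (fun _ => c)); [assumption|apply ex_RInt_const].
Qed.

Lemma is_RInt_shift (f : R -> V) (s a b : R) (I : V) :
  is_RInt f (s + a) (s + b) I -> is_RInt (fun r => f (s + r)) a b I.
Proof.
  intros Hf. apply (is_RInt_ext (fun r => scal 1 (f (1 * r + s)))).
  - intros r _. replace (1 * r + s) with (s + r) by ring.
    exact (scal_one (f (s + r))).
  - apply (is_RInt_comp_lin f 1 s).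
    now replace (1 * a + s) with (s + a) by ring;
      replace (1 * b + s) with (s + b) by ring.
Qed.

Lemma is_RInt_reflect (f : R -> V) (t : R) (I : V) :
  is_RInt f 0 t I -> is_RInt (fun r => f (t - r)) 0 t I.
Proof.
  intros Hf. apply is_RInt_swap in Hf.
  apply (is_RInt_ext (fun r => opp (scal (-1) (f (-1 * r + t))))).
  - intros r _. replace (-1 * r + t) with (t - r) by ring. vec_in V.
  - replace I with (opp (opp I)) by vec_in V.
    apply (is_RInt_opp (fun r => scal (-1) (f (-1 * r + t)))).
    apply (is_RInt_comp_lin f (-1) t).
    now replace (-1 * 0 + t) with t by ring;
      replace (-1 * t + t) with 0 by ring.
Qed.

Lemma ex_RInt_cont (f : R -> V) (a b : R) :
  (forall s, continuous f s) -> ex_RInt f a b.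
Proof. intros Hf. apply (ex_RInt_continuous f). intros s _. apply Hf. Qed.

End Integrals.

(** * Strongly continuous semigroups *)

Section Semigroups.

Context {V : CompleteNormedModule R_AbsRing}.

Record semigroup (T : R -> V -> V) : Prop := {
  sg_linear : forall t, 0 <= t -> is_linear (T t);
  sg_zero : forall x, T 0 x = x;
  sg_add : forall s t x, 0 <= s -> 0 <= t -> T (s + t) x = T s (T t x);
  sg_right_cont : forall (x : V) e, 0 < e ->
    exists d, 0 < d /\ forall h, 0 < h < d -> norm (minus (T h x) x) < e
}.

Definition right_deriv (T : R -> V -> V) (x y : V) : Prop :=
  forall e, 0 < e -> exists d, 0 < d /\
    forall h, 0 < h < d -> norm (minus (minus (T h x) x) (scal h y)) <= e * h.

Context (T : R -> V -> V) (HT : semigroup T).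

Lemma sg_minus t (x y : V) : 0 <= t -> T t (minus x y) = minus (T t x) (T t y).
Proof. intros Ht. apply lin_minus, HT, Ht. Qed.

(** If no such interval existed, some operators [T (t n)] with [t n] tending
    to [0] would be unbounded, although [T (t n) x] converges to [x] for each
    [x]. *)
Lemma sg_bound_near_0 :
  exists d M, 0 < d /\ 1 <= M /\
    forall t (x : V), 0 <= t <= d -> norm (T t x) <= M * norm x.
Proof.
  apply NNPP. intros Hn.
  assert (Hbad : forall n, exists t, 0 < t <= / (INR n + 1) /\
                  exists x : V, (INR n + 1) * norm x < norm (T t x)).
  { intros n. apply NNPP. intros Hno. apply Hn.
    pose proof (pos_INR n) as Hpos.
    exists (/ (INR n + 1)), (INR n + 1). split; [|split].
    - apply Rinv_0_lt_compat. lra.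
    - lra.
    - intros t x Ht. destruct (Req_dec t 0) as [->|Ht0].
      + rewrite (sg_zero T HT). pose proof (norm_ge_0 x). nra.
      + apply Rnot_lt_le. intros Hlt. apply Hno. exists t.
        split; [lra|now exists x]. }
  set (t := fun n => proj1_sig (constructive_indefinite_description _ (Hbad n))).
  assert (Ht : forall n, 0 < t n <= / (INR n + 1) /\
                exists x : V, (INR n + 1) * norm x < norm (T (t n) x)).
  { intros n. unfold t. apply proj2_sig. }
  destruct (uniform_boundedness nat (fun n => T (t n))) as [M HM].
  - intros n. apply HT. destruct (Ht n). lra.
  - intros x.
    destruct (filterlim_bounded (fun n => T (t n) x)) as [C HC].
    + exists x.
      apply (filterlim_locally_ball_norm (F := eventually) (fun n => T (t n) x)).
      intros e. destruct (sg_right_cont T HT x e (cond_pos e)) as [d [Hd HTd]].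
      destruct (archimed_cor1 d Hd) as [N [HN HN0]].
      exists N. intros n Hnn. apply HTd. destruct (Ht n) as [[H1 H2] _].
      split; [assumption|]. apply Rle_lt_trans with (1 := H2).
      apply Rle_lt_trans with (2 := HN). apply lt_INR in HN0. simpl in HN0.
      apply le_INR in Hnn. apply Rinv_le_contravar; lra.
    + exists C. exact HC.
  - destruct (INR_unbounded M) as [n Hnn].
    destruct (Ht n) as [_ [x Hx]]. specialize (HM n x).
    pose proof (norm_ge_0 x). nra.
Qed.

Lemma sg_bound (a : R) :
  exists M, 1 <= M /\
    forall t (x : V), 0 <= t <= a -> norm (T t x) <= M * norm x.
Proof.
  destruct sg_bound_near_0 as [d [M [Hd [HM Hb]]]].
  assert (Hn : forall n t (x : V), 0 <= t <= INR n * d ->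
            norm (T t x) <= M ^ n * norm x).
  { induction n as [|n IH]; intros t x Ht.
    - simpl in *. replace t with 0 by lra. rewrite (sg_zero T HT). lra.
    - rewrite S_INR in Ht. pose proof (pow_R1_Rle M n HM) as Hpow.
      pose proof (norm_ge_0 x) as Hx. simpl.
      destruct (Rle_lt_dec t d) as [Htd|Htd].
      + apply Rle_trans with (1 := Hb t x ltac:(lra)).
        apply Rmult_le_compat_r; [assumption|nra].
      + replace t with (d + (t - d)) by ring.
        rewrite (sg_add T HT) by lra.
        apply Rle_trans with (1 := Hb d _ ltac:(lra)).
        specialize (IH (t - d) x ltac:(lra)). rewrite Rmult_assoc.
        apply Rmult_le_compat_l; lra. }
  destruct (INR_unbounded (a / d)) as [n Hnd].
  exists (M ^ n). split; [now apply pow_R1_Rle|].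
  intros t x Ht. apply Hn. split; [lra|].
  apply (Rmult_lt_compat_r d) in Hnd; [|assumption].
  replace (a / d * d) with a in Hnd by (field; lra). lra.
Qed.

Lemma sg_cont (s : R) (x : V) e : 0 <= s -> 0 < e ->
  exists d, 0 < d /\ forall r, 0 <= r -> Rabs (r - s) < d ->
    norm (minus (T r x) (T s x)) < e.
Proof.
  intros Hs He. destruct (sg_bound (s + 1)) as [M [HM Hb]].
  destruct (sg_right_cont T HT x (e / M)) as [d [Hd HTd]].
  { apply Rdiv_lt_0_compat; lra. }
  exists (Rmin d 1). split; [apply Rmin_pos; lra|].
  intros r Hr Hrs.
  pose proof (Rmin_l d 1). pose proof (Rmin_r d 1).
  assert (HeM : M * (e / M) = e) by (field; lra).
  destruct (Rtotal_order r s) as [Hlt|[->|Hgt]].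
  - rewrite Rabs_left in Hrs by lra.
    replace (T s x) with (T r (T (s - r) x)).
    2:{ rewrite <- (sg_add T HT) by lra. f_equal. ring. }
    rewrite <- sg_minus by assumption.
    apply Rle_lt_trans with (1 := Hb r _ ltac:(lra)).
    rewrite norm_minus_sym. specialize (HTd (s - r) ltac:(lra)).
    apply (Rmult_lt_compat_l M) in HTd; lra.
  - rewrite norm_minus_self. assumption.
  - rewrite Rabs_right in Hrs by lra.
    replace (T r x) with (T s (T (r - s) x)).
    2:{ rewrite <- (sg_add T HT) by lra. f_equal. ring. }
    rewrite <- sg_minus by assumption.
    apply Rle_lt_trans with (1 := Hb s _ ltac:(lra)).
    specialize (HTd (r - s) ltac:(lra)).
    apply (Rmult_lt_compat_l M) in HTd; lra.
Qed.

Lemma sg_continuous (g : R -> R) (f : R -> V) (s : R) :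
  (forall r, 0 <= g r) -> cont_at g s -> continuous f s ->
  continuous (fun r => T (g r) (f r)) s.
Proof.
  intros Hg0 Hg Hf. apply continuous_norm_iff. intros e He.
  rewrite continuous_norm_iff in Hf.
  destruct (sg_bound (g s + 1)) as [M [HM Hb]].
  destruct (Hf (e / 2 / M)) as [d1 [Hd1 H1]].
  { apply Rdiv_lt_0_compat; lra. }
  destruct (sg_cont (g s) (f s) (e / 2)) as [d2 [Hd2 H2]]; [apply Hg0|lra|].
  destruct (Hg (Rmin 1 d2)) as [d3 [Hd3 H3]]; [apply Rmin_pos; lra|].
  exists (Rmin d1 d3). split; [now apply Rmin_pos|]. intros r Hr.
  pose proof (Rmin_l d1 d3). pose proof (Rmin_r d1 d3).
  pose proof (Rmin_l 1 d2). pose proof (Rmin_r 1 d2).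
  specialize (H1 r ltac:(lra)). specialize (H3 r ltac:(lra)).
  specialize (H2 (g r) (Hg0 r) ltac:(lra)). apply Rabs_def2 in H3.
  apply Rle_lt_trans with (1 := norm_minus_triangle _ (T (g r) (f s)) _).
  specialize (Hg0 r). rewrite <- sg_minus by assumption.
  specialize (Hb (g r) (minus (f r) (f s)) ltac:(lra)).
  apply (Rmult_lt_compat_l M) in H1; [|lra].
  replace (M * (e / 2 / M)) with (e / 2) in H1 by (field; lra). lra.
Qed.

Lemma cont_at_clamp (t s : R) : cont_at (fun r => Rmax 0 (t - r)) s.
Proof.
  intros e He. exists e. split; [assumption|]. intros r Hr.
  apply Rabs_def2 in Hr. unfold Rmax.
  destruct (Rle_dec 0 (t - r)), (Rle_dec 0 (t - s)); apply Rabs_def1; lra.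
Qed.

Lemma cont_at_clamp_id (s : R) : cont_at (fun r => Rmax 0 r) s.
Proof.
  intros e He. exists e. split; [assumption|]. intros r Hr.
  apply Rabs_def2 in Hr. unfold Rmax.
  destruct (Rle_dec 0 r), (Rle_dec 0 s); apply Rabs_def1; lra.
Qed.

Lemma ex_RInt_convolution (f : R -> V) (t a b : R) :
  (forall s, continuous f s) -> a <= t -> b <= t ->
  ex_RInt (fun s => T (t - s) (f s)) a b.
Proof.
  intros Hf Ha Hb.
  apply (ex_RInt_ext (fun s => T (Rmax 0 (t - s)) (f s))).
  - intros s Hs. f_equal. apply Rmax_right.
    assert (Rmax a b <= t) by now apply Rmax_lub. lra.
  - apply ex_RInt_cont. intros s. apply sg_continuous; [|apply cont_at_clamp|easy].
    intros r. apply Rmax_l.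
Qed.

Lemma ex_RInt_orbit (x : V) (a b : R) : 0 <= a -> 0 <= b ->
  ex_RInt (fun s => T s x) a b.
Proof.
  intros Ha Hb.
  apply (ex_RInt_ext (fun s => T (Rmax 0 s) x)).
  - intros s Hs. f_equal. apply Rmax_right.
    assert (0 <= Rmin a b) by now apply Rmin_glb. lra.
  - apply ex_RInt_cont. intros s.
    apply (sg_continuous (fun r => Rmax 0 r) (fun _ => x));
      [|apply cont_at_clamp_id|apply continuous_const].
    intros r. apply Rmax_l.
Qed.

(** The integrated semigroup. *)
Definition orbit_integral (t : R) (x : V) : V := RInt (fun s => T s x) 0 t.

Lemma orbit_integral_linear t : 0 <= t -> is_linear (orbit_integral t).
Proof.
  intros Ht. unfold orbit_integral. split.
  - intros x y.
    transitivity (RInt (fun s => plus (T s x) (T s y)) 0 t).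
    + apply (RInt_ext (V := V)). rewrite Rmin_left, Rmax_right by assumption.
      intros s Hs. apply lin_plus, HT. lra.
    + apply (RInt_plus (V := V)); apply ex_RInt_orbit; lra.
  - intros r x.
    transitivity (RInt (fun s => scal r (T s x)) 0 t).
    + apply (RInt_ext (V := V)). rewrite Rmin_left, Rmax_right by assumption.
      intros s Hs. apply lin_scal, HT. lra.
    + apply (RInt_scal (V := V)); apply ex_RInt_orbit; lra.
  - destruct (sg_bound t) as [M [HM Hb]]. exists (t * M + 1).
    split; [nra|]. intros x.
    apply Rle_trans with ((t - 0) * (M * norm x)).
    + apply (norm_RInt_bound (V := V)); [assumption|apply ex_RInt_orbit; lra|].
      intros s Hs. apply Hb. lra.
    + pose proof (norm_ge_0 x). nra.
Qed.

Lemma orbit_integral_add a b x : 0 <= a -> 0 <= b ->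
  orbit_integral (a + b) x = plus (orbit_integral a x) (T a (orbit_integral b x)).
Proof.
  intros Ha Hb. unfold orbit_integral.
  rewrite <- (RInt_Chasles (fun s => T s x) 0 a (a + b))
    by (apply ex_RInt_orbit; lra).
  f_equal. rewrite <- RInt_linear; [|now apply HT|apply ex_RInt_orbit; lra].
  symmetry. apply is_RInt_unique.
  apply (is_RInt_ext (fun s => T (a + s) x)).
  - rewrite Rmin_left, Rmax_right by assumption. intros s Hs.
    apply HT; lra.
  - apply (is_RInt_shift (fun s => T s x)). rewrite Rplus_0_r.
    apply (RInt_correct (V := V)), ex_RInt_orbit; lra.
Qed.

Lemma orbit_integral_comm a b x : 0 <= a -> 0 <= b ->
  orbit_integral b (T a x) = T a (orbit_integral b x).
Proof.
  intros Ha Hb. unfold orbit_integral.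
  rewrite <- RInt_linear; [|now apply HT|apply ex_RInt_orbit; lra].
  apply (RInt_ext (V := V)). rewrite Rmin_left, Rmax_right by assumption.
  intros s Hs. rewrite <- !(sg_add T HT) by lra. f_equal. ring.
Qed.

(** Both sides equal
    [orbit_integral (t + d) x - orbit_integral t x - orbit_integral d x]. The
    identity trades a difference over the short time [t] for an integral over
    that time, which is how integration makes orbits differentiable. *)
Lemma orbit_integral_swap t d x : 0 <= t -> 0 <= d ->
  minus (T t (orbit_integral d x)) (orbit_integral d x) =
  minus (T d (orbit_integral t x)) (orbit_integral t x).
Proof.
  intros Ht Hd.
  pose proof (orbit_integral_add t d x Ht Hd) as H1.
  pose proof (orbit_integral_add d t x Hd Ht) as H2.
  rewrite (Rplus_comm d t), H1 in H2.
  replace (T t (orbit_integral d x))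
    with (minus (plus (orbit_integral t x) (T t (orbit_integral d x)))
            (orbit_integral t x)) by vec_in V.
  rewrite H2. vec_in V.
Qed.

Lemma orbit_integral_deriv (x : V) e : 0 < e ->
  exists d, 0 < d /\ forall h, 0 < h < d ->
    norm (minus (orbit_integral h x) (scal h x)) <= h * e.
Proof.
  intros He. destruct (sg_right_cont T HT x e He) as [d [Hd HTd]].
  exists d. split; [assumption|]. intros h Hh.
  apply RInt_near; [lra|apply ex_RInt_orbit; lra|].
  intros s Hs. destruct (Req_dec s 0) as [->|Hs0].
  - rewrite (sg_zero T HT), norm_minus_self. lra.
  - apply Rlt_le, HTd. lra.
Qed.

Lemma right_deriv_invariant s x y : 0 <= s ->
  right_deriv T x y -> right_deriv T (T s x) (T s y).
Proof.
  intros Hs H e He. destruct (sg_bound s) as [M [HM Hb]].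
  destruct (H (e / M)) as [d [Hd Hq]]; [apply Rdiv_lt_0_compat; lra|].
  exists d. split; [assumption|]. intros h Hh.
  rewrite <- (sg_add T HT) by lra. rewrite (Rplus_comm h s).
  rewrite (sg_add T HT) by lra.
  rewrite <- (lin_scal (T s)) by now apply HT.
  rewrite <- !sg_minus by assumption.
  apply Rle_trans with (1 := Hb s _ ltac:(lra)).
  specialize (Hq h Hh). apply (Rmult_le_compat_l M) in Hq; [|lra].
  replace (M * (e / M * h)) with (e * h) in Hq by (field; lra). exact Hq.
Qed.

Lemma orbit_integral_right_deriv d x : 0 <= d ->
  right_deriv T (orbit_integral d x) (minus (T d x) x).
Proof.
  intros Hd e He. destruct (sg_bound d) as [M [HM Hb]].
  destruct (orbit_integral_deriv x (e / (M + 1))) as [c [Hc Hq]].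
  { apply Rdiv_lt_0_compat; lra. }
  exists c. split; [assumption|]. intros h Hh.
  rewrite orbit_integral_swap by lra.
  set (z := minus (orbit_integral h x) (scal h x)).
  replace (minus (minus (T d (orbit_integral h x)) (orbit_integral h x))
             (scal h (minus (T d x) x))) with (minus (T d z) z).
  2:{ unfold z. rewrite sg_minus, (lin_scal (T d)) by (try apply HT; assumption).
      vec_in V. }
  apply Rle_trans with (1 := norm_minus_le _ _).
  specialize (Hb d z ltac:(lra)). specialize (Hq h Hh). fold z in Hq.
  apply (Rmult_le_compat_l (M + 1)) in Hq; [|lra].
  replace ((M + 1) * (h * (e / (M + 1)))) with (e * h) in Hq by (field; lra).
  lra.
Qed.

(** The averages of the orbit of [x] over short intervals lie in the domain and
    converge to [x]. *)
Lemma generator_dense (x : V) e : 0 < e ->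
  exists z y : V, right_deriv T z y /\ norm (minus z x) <= e.
Proof.
  intros He. destruct (orbit_integral_deriv x e He) as [c [Hc Hq]].
  set (h := c / 2). assert (Hh : 0 < h < c) by (unfold h; lra).
  assert (Hinv : 0 < / h) by (apply Rinv_0_lt_compat; lra).
  exists (scal (/ h) (orbit_integral h x)), (scal (/ h) (minus (T h x) x)).
  split.
  - intros f Hf.
    destruct (orbit_integral_right_deriv h x ltac:(lra) (f * h)) as [d [Hd Hr]].
    { nra. }
    exists d. split; [assumption|]. intros k Hk.
    rewrite (lin_scal (T k)) by (apply HT; lra).
    match goal with |- norm ?u <= _ =>
      replace u with (scal (/ h) (minus (minus (T k (orbit_integral h x))
        (orbit_integral h x)) (scal k (minus (T h x) x)))) by vec_in V end.
    rewrite norm_scal_pos by lra. specialize (Hr k Hk).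
    apply (Rmult_le_compat_l (/ h)) in Hr; [|lra].
    replace (/ h * (f * h * k)) with (f * k) in Hr by (field; lra). exact Hr.
  - match goal with |- norm ?u <= _ => replace u with
      (scal (/ h) (minus (orbit_integral h x) (scal h x))) by vec_in V end.
    rewrite norm_scal_pos by lra. specialize (Hq h Hh).
    apply (Rmult_le_compat_l (/ h)) in Hq; [|lra].
    replace (/ h * (h * e)) with e in Hq by (field; lra). exact Hq.
Qed.

End Semigroups.

(** * Bounded perturbations of a generator *)

Lemma le_of_small_excess (x y K : R) :
  (forall e, 0 < e -> x <= y + K * e) -> x <= y.
Proof.
  intros H. apply Rnot_lt_le. intros Hlt.
  pose proof (Rabs_pos K). pose proof (Rle_abs K).
  set (e := (x - y) / (2 * (Rabs K + 1))).
  assert (He : 0 < e) by (apply Rdiv_lt_0_compat; lra).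
  specialize (H e He).
  assert (HK : (Rabs K + 1) * e = (x - y) / 2) by (unfold e; field; lra).
  nra.
Qed.

Section Perturbation.

Context {V : CompleteNormedModule R_AbsRing}.
Context (T S : R -> V -> V) (E : V -> V).
Context (HT : semigroup T) (HS : semigroup S) (HE : is_linear E).

(** The generator of [S] extends that of [T] plus [E]. Asking only for some
    right derivative [a] avoids any appeal to its uniqueness. *)
Context (HTS : forall x y, right_deriv T x y ->
  exists a, right_deriv T x a /\ right_deriv S x (plus a (E x))).

Lemma generator_gap (x y : V) e : right_deriv T x y -> 0 < e ->
  exists d, 0 < d /\ forall h, 0 < h < d ->
    norm (plus (minus (T h x) (S h x)) (scal h (E x))) <= e * h.
Proof.
  intros Hx He. destruct (HTS x y Hx) as [a [Ha Hb]].
  destruct (Ha (e / 2)) as [d1 [Hd1 H1]]; [lra|].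
  destruct (Hb (e / 2)) as [d2 [Hd2 H2]]; [lra|].
  exists (Rmin d1 d2). split; [now apply Rmin_pos|]. intros h Hh.
  pose proof (Rmin_l d1 d2). pose proof (Rmin_r d1 d2).
  specialize (H1 h ltac:(lra)). specialize (H2 h ltac:(lra)).
  eapply Rle_trans; [apply (norm_split_minus _
      (minus (minus (T h x) x) (scal h a))
      (minus (minus (S h x) x) (scal h (plus a (E x)))));
    vec_in V|]. lra.
Qed.

(** For [x] in the domain, [s |-> S (t - s) (T s x)] has right derivative
    [- S (t - s) (E (T s x))]; the bound then follows by integrating. *)
Lemma perturbation_bound_domain (t MT MS ME : R) (x y : V) :
  0 <= t -> 1 <= MS ->
  (forall s (z : V), 0 <= s <= t -> norm (T s z) <= MT * norm z) ->
  (forall s (z : V), 0 <= s <= t -> norm (S s z) <= MS * norm z) ->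
  0 <= ME -> (forall z : V, norm (E z) <= ME * norm z) ->
  right_deriv T x y ->
  norm (minus (T t x) (S t x)) <= MS * (ME * (MT * norm x)) * t.
Proof.
  intros Ht HMS HbT HbS HME HbE Hx.
  set (K := MS * (ME * (MT * norm x))).
  set (g := fun s => S (Rmax 0 (t - s)) (T (Rmax 0 s) x)).
  assert (Hg : forall s, continuous g s).
  { intros s.
    apply (sg_continuous S HS (fun r => Rmax 0 (t - r))
             (fun r => T (Rmax 0 r) x)).
    - intros r. apply Rmax_l.
    - apply cont_at_clamp.
    - apply (sg_continuous T HT (fun r => Rmax 0 r) (fun _ => x)).
      + intros r. apply Rmax_l.
      + apply cont_at_clamp_id.
      + apply continuous_const. }
  assert (Hgs : forall s, 0 <= s <= t -> g s = S (t - s) (T s x)).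
  { intros s Hs. unfold g. rewrite !Rmax_right by lra. reflexivity. }
  assert (Hcmp : forall s, 0 <= s <= t -> norm (minus (g s) (g 0)) <= K * s).
  { apply (dini_comparison _ _ (fun _ => K) 0 K t Ht).
    - intros s _. apply (cont_at_norm g (fun z => norm (minus z (g 0))) 1 s).
      + intros u w. apply norm_lipschitz.
      + apply Hg.
    - intros s. auto_derive; [easy|ring].
    - rewrite norm_minus_self. lra.
    - intros s Hs e He.
      destruct (generator_gap (T s x) (T s y) (e / MS)) as [d [Hd Hq]].
      { apply right_deriv_invariant; [assumption|lra|assumption]. }
      { apply Rdiv_lt_0_compat; lra. }
      exists (Rmin d (t - s)). split; [apply Rmin_pos; lra|]. intros h Hh.
      pose proof (Rmin_l d (t - s)). pose proof (Rmin_r d (t - s)).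
      apply Rle_trans with (1 := norm_minus_triangle _ (g s) _).
      assert (norm (minus (g (s + h)) (g s)) <= h * (K + e)); [|lra].
      rewrite !Hgs by lra.
      replace (T (s + h) x) with (T h (T s x))
        by (rewrite (Rplus_comm s h); symmetry; apply HT; lra).
      replace (S (t - s) (T s x)) with (S (t - (s + h)) (S h (T s x)))
        by (rewrite <- (sg_add S HS) by lra; f_equal; ring).
      rewrite <- (sg_minus S HS) by lra.
      apply Rle_trans with (1 := HbS (t - (s + h)) _ ltac:(lra)).
      specialize (Hq h ltac:(lra)).
      assert (Hw : norm (minus (T h (T s x)) (S h (T s x)))
                   <= e / MS * h + h * norm (E (T s x))).
      { match goal with |- norm ?u <= _ => replace u with
          (minus (plus u (scal h (E (T s x)))) (scal h (E (T s x))))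
          by vec_in V end.
        apply Rle_trans with (1 := norm_minus_le _ _).
        rewrite (norm_scal_pos h) by lra. lra. }
      specialize (HbE (T s x)). specialize (HbT s x ltac:(lra)).
      assert (Hw2 : norm (E (T s x)) <= ME * (MT * norm x)).
      { apply Rle_trans with (1 := HbE). now apply Rmult_le_compat_l. }
      apply Rle_trans with (MS * (e / MS * h + h * (ME * (MT * norm x)))).
      { apply Rmult_le_compat_l; [lra|]. apply Rle_trans with (1 := Hw).
        apply Rplus_le_compat_l, Rmult_le_compat_l; [lra|assumption]. }
      right. unfold K. field. lra.
    - intros s Hs. lra. }
  specialize (Hcmp t ltac:(lra)). rewrite !Hgs in Hcmp by lra.
  rewrite Rminus_diag, (sg_zero S HS), (sg_zero T HT), Rminus_0_r in Hcmp.
  exact Hcmp.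
Qed.

Lemma perturbation_bound :
  exists C, 0 <= C /\ forall t (x : V), 0 <= t <= 1 ->
    norm (minus (T t x) (S t x)) <= C * t * norm x.
Proof.
  destruct (sg_bound T HT 1) as [MT [HMT HbT]].
  destruct (sg_bound S HS 1) as [MS [HMS HbS]].
  pose proof (op_norm_ge0 E HE) as HME.
  set (ME := op_norm E) in *.
  exists (MS * (ME * MT)). split; [apply Rmult_le_pos; [lra|nra]|].
  intros t x Ht.
  assert (HC : 0 <= MS * (ME * MT)) by (apply Rmult_le_pos; [lra|nra]).
  apply le_of_small_excess with (MT + MS * (ME * MT) * t + MS).
  intros e He. destruct (generator_dense T HT x e He) as [z [y [Hz Hzx]]].
  assert (Hb : norm (minus (T t z) (S t z)) <= MS * (ME * (MT * norm z)) * t).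
  { apply perturbation_bound_domain with y; try assumption; [lra| | |].
    - intros s w Hs. apply HbT. lra.
    - intros s w Hs. apply HbS. lra.
    - intros w. now apply op_norm_bound. }
  assert (HT1 : norm (T t (minus z x)) <= MT * e).
  { apply Rle_trans with (1 := HbT t _ Ht). apply Rmult_le_compat_l; lra. }
  assert (HS1 : norm (S t (minus z x)) <= MS * e).
  { apply Rle_trans with (1 := HbS t _ Ht). apply Rmult_le_compat_l; lra. }
  assert (Hnz : norm z <= norm x + e).
  { apply Rle_trans with (1 := norm_le_minus z x). lra. }
  rewrite (sg_minus T HT) in HT1 by lra. rewrite (sg_minus S HS) in HS1 by lra.
  eapply Rle_trans; [apply (norm_split_plus _
      (minus (minus (T t z) (S t z)) (minus (T t z) (T t x)))
      (minus (S t z) (S t x)));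
    vec_in V|].
  pose proof (norm_minus_le (minus (T t z) (S t z)) (minus (T t z) (T t x))).
  assert (MS * (ME * (MT * norm z)) * t
          <= MS * (ME * MT) * t * (norm x + e)).
  { replace (MS * (ME * (MT * norm z)) * t)
      with (MS * (ME * MT) * t * norm z) by ring.
    apply Rmult_le_compat_l; [|assumption]. apply Rmult_le_pos; lra. }
  lra.
Qed.

(** The two semigroups are compared on all of the space although neither
    orbit need be differentiable: the bound of [perturbation_bound] makes the
    difference quotients equicontinuous, so that convergence on the dense
    domain suffices. *)
Lemma perturbation_deriv (x : V) e : 0 < e ->
  exists d, 0 < d /\ forall h, 0 < h < d ->
    norm (plus (minus (T h x) (S h x)) (scal h (E x))) <= e * h.
Proof.
  intros He. destruct perturbation_bound as [C [HC Hb]].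
  pose proof (op_norm_ge0 E HE) as HME. set (ME := op_norm E) in *.
  set (e1 := e / 2 / (C + ME + 1)).
  assert (He1 : 0 < e1) by (repeat apply Rdiv_lt_0_compat; lra).
  destruct (generator_dense T HT x e1 He1) as [z [y [Hz Hzx]]].
  destruct (generator_gap z y (e / 2) Hz) as [d [Hd Hq]]; [lra|].
  exists (Rmin d 1). split; [apply Rmin_pos; lra|]. intros h Hh.
  pose proof (Rmin_l d 1). pose proof (Rmin_r d 1).
  specialize (Hq h ltac:(lra)). specialize (Hb h (minus z x) ltac:(lra)).
  rewrite (sg_minus T HT), (sg_minus S HS) in Hb by lra.
  pose proof (op_norm_bound E (minus z x) HE) as HE1. fold ME in HE1.
  rewrite (lin_minus E) in HE1 by assumption.
  eapply Rle_trans; [apply (norm_split_minus _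
      (plus (minus (T h z) (S h z)) (scal h (E z)))
      (plus (minus (minus (T h z) (T h x)) (minus (S h z) (S h x)))
         (scal h (minus (E z) (E x)))));
    vec_in V|].
  pose proof (norm_plus_le (minus (minus (T h z) (T h x)) (minus (S h z) (S h x)))
    (scal h (minus (E z) (E x)))) as Ht.
  rewrite (norm_scal_pos h) in Ht by lra.
  assert (C * h * norm (minus z x) <= C * h * e1)
    by (apply Rmult_le_compat_l; [apply Rmult_le_pos|]; lra).
  assert (h * norm (minus (E z) (E x)) <= h * (ME * e1)).
  { apply Rmult_le_compat_l; [lra|]. apply Rle_trans with (1 := HE1).
    now apply Rmult_le_compat_l. }
  assert (Hsum : (C + ME + 1) * e1 = e / 2) by (unfold e1; field; lra).
  assert (0 <= e1 * h) by (apply Rmult_le_pos; lra).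
  assert ((C + ME + 1) * e1 * h = e / 2 * h) by now rewrite Hsum.
  canon V. lra.
Qed.

End Perturbation.

(** * Mild solutions *)

Section MildSolutions.

Context {V : CompleteNormedModule R_AbsRing}.
Context (T : R -> V -> V) (HT : semigroup T).
Context (y f : R -> V) (a : R).
Context (Hf : forall s, continuous f s).
Context (Hy : forall t, 0 <= t <= a ->
  y t = plus (T t (y 0)) (RInt (fun s => T (t - s) (f s)) 0 t)).

Lemma mild_restart s h : 0 <= s -> 0 <= h -> s + h <= a ->
  y (s + h) = plus (T h (y s)) (RInt (fun r => T (h - r) (f (s + r))) 0 h).
Proof.
  intros Hs Hh Ha. rewrite (Hy (s + h)), (Hy s) by lra.
  rewrite (lin_plus (T h)) by now apply HT.
  rewrite <- (sg_add T HT) by lra. rewrite (Rplus_comm h s).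
  rewrite <- (RInt_Chasles (fun r => T (s + h - r) (f r)) 0 s (s + h))
    by (apply ex_RInt_convolution; (assumption || lra)).
  replace (RInt (fun r => T (s + h - r) (f r)) 0 s)
    with (T h (RInt (fun r => T (s - r) (f r)) 0 s)).
  2:{ rewrite <- RInt_linear;
        [|now apply HT|apply ex_RInt_convolution; (assumption || lra)].
      apply (RInt_ext (V := V)). rewrite Rmin_left, Rmax_right by assumption.
      intros r Hr. rewrite <- (sg_add T HT) by lra. f_equal. ring. }
  replace (RInt (fun r => T (s + h - r) (f r)) s (s + h))
    with (RInt (fun r => T (h - r) (f (s + r))) 0 h).
  2:{ apply is_RInt_unique.
      apply (is_RInt_ext (fun r => T (s + h - (s + r)) (f (s + r)))).
      - intros r _. f_equal. ring.
      - apply (is_RInt_shift (fun r => T (s + h - r) (f r))).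
        rewrite Rplus_0_r. apply (RInt_correct (V := V)).
        apply ex_RInt_convolution; (assumption || lra). }
  vec_in V.
Qed.

Context (S : R -> V -> V) (E : V -> V) (HS : semigroup S) (HE : is_linear E).
Context (HTS : forall x y, right_deriv T x y ->
  exists b, right_deriv T x b /\ right_deriv S x (plus b (E x))).

(** A mild solution driven by the generator of [T] with forcing [f] moves to
    first order like one driven by the generator of [S] with forcing
    [f - E y]. Only this local form of the variation-of-constants formula is
    used below, so that no double integral has to be exchanged. *)
Lemma mild_increment s e : 0 <= s < a -> 0 < e ->
  exists d, 0 < d /\ forall h, 0 < h < d -> s + h <= a /\
    norm (minus (y (s + h))
      (plus (S h (y s)) (scal h (minus (f s) (E (y s)))))) <= e * h.
Proof.
  intros Hs He.
  destruct (perturbation_deriv T S E HT HS HE HTS (y s) (e / 2))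
    as [d1 [Hd1 H1]]; [lra|].
  destruct (sg_bound T HT 1) as [M [HM HbT]].
  destruct (proj1 (continuous_norm_iff f s) (Hf s) (e / 4 / M)) as [d2 [Hd2 H2]].
  { repeat apply Rdiv_lt_0_compat; lra. }
  destruct (sg_right_cont T HT (f s) (e / 4)) as [d3 [Hd3 H3]]; [lra|].
  exists (Rmin (Rmin d1 d2) (Rmin (Rmin d3 1) (a - s))).
  split; [repeat apply Rmin_pos; lra|]. intros h Hh.
  pose proof (Rmin_l (Rmin d1 d2) (Rmin (Rmin d3 1) (a - s))).
  pose proof (Rmin_r (Rmin d1 d2) (Rmin (Rmin d3 1) (a - s))).
  pose proof (Rmin_l d1 d2). pose proof (Rmin_r d1 d2).
  pose proof (Rmin_l (Rmin d3 1) (a - s)). pose proof (Rmin_r (Rmin d3 1) (a - s)).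
  pose proof (Rmin_l d3 1). pose proof (Rmin_r d3 1).
  split; [lra|]. rewrite mild_restart by lra.
  set (J := RInt (fun r => T (h - r) (f (s + r))) 0 h).
  assert (HJ : norm (minus J (scal h (f s))) <= h * (e / 2)).
  { apply RInt_near; [lra| |].
    - apply (ex_RInt_convolution T HT (fun r => f (s + r))); [|lra|lra].
      intros r. apply continuous_comp; [|apply Hf].
      apply (continuous_plus (fun _ => s) (fun r => r));
        [apply continuous_const|apply continuous_id].
    - intros r Hr.
      apply Rle_trans with (1 := norm_minus_triangle _ (T (h - r) (f s)) _).
      rewrite <- (sg_minus T HT) by lra.
      pose proof (HbT (h - r) (minus (f (s + r)) (f s)) ltac:(lra)) as Hb1.
      specialize (H2 (s + r)). replace (s + r - s) with r in H2 by ring.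
      rewrite Rabs_right in H2 by lra. specialize (H2 ltac:(lra)).
      apply (Rmult_lt_compat_l M) in H2; [|lra].
      replace (M * (e / 4 / M)) with (e / 4) in H2 by (field; lra).
      destruct (Req_dec h r) as [->|Hne].
      + rewrite Rminus_diag, (sg_zero T HT (f s)), norm_minus_self.
        rewrite Rminus_diag in Hb1. lra.
      + specialize (H3 (h - r) ltac:(lra)). lra. }
  specialize (H1 h ltac:(lra)).
  eapply Rle_trans; [apply (norm_split_plus _
      (plus (minus (T h (y s)) (S h (y s))) (scal h (E (y s))))
      (minus J (scal h (f s))));
    vec_in V|]. lra.
Qed.

End MildSolutions.

(** * A norm in which the stable semigroup contracts *)

Lemma exp_neg_le (g N e : R) : 0 < g -> 0 <= N -> 0 < e ->
  exists d, 0 < d /\ forall h, 0 < h < d ->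
    exp (- g * h) * N <= N + h * (- g * N + e).
Proof.
  intros Hg HN He. exists (e / (g * g * (N + 1))).
  assert (Hden : 0 < g * g * (N + 1)) by (apply Rmult_lt_0_compat; nra).
  split; [now apply Rdiv_lt_0_compat|]. intros h [Hh0 Hh].
  apply (Rmult_lt_compat_r (g * g * (N + 1))) in Hh; [|assumption].
  replace (e / (g * g * (N + 1)) * (g * g * (N + 1))) with e in Hh
    by (field; nra).
  set (u := g * h) in *. assert (Hu : 0 < u) by (unfold u; nra).
  (* [exp (- u) <= 1 / (1 + u) <= 1 - u + u ^ 2] *)
  assert (Hexp : exp (- u) <= 1 - u + u * u).
  { pose proof (exp_ineq1 u ltac:(lra)) as H1.
    assert (Hinv : exp (- u) * exp u = 1)
      by (rewrite <- exp_plus, Rplus_opp_l; apply exp_0).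
    pose proof (exp_pos (- u)) as Hpos.
    assert (exp (- u) * (1 + u) <= 1) by nra.
    assert (0 < u * u) by nra.
    apply Rmult_le_reg_r with (1 + u); [lra|]. nra. }
  replace (- g * h) with (- u) by (unfold u; ring).
  apply (Rmult_le_compat_r N) in Hexp; [|assumption].
  apply Rle_trans with (1 := Hexp).
  replace (h * (- g * N + e)) with (- u * N + h * e) by (unfold u; ring).
  assert (u * u * N <= h * e); [|lra].
  replace (u * u * N) with (h * (h * (g * g * N))) by (unfold u; ring).
  apply Rmult_le_compat_l; [lra|]. nra.
Qed.

Section AdaptedNorm.

Context {V : CompleteNormedModule R_AbsRing}.
Context (S : R -> V -> V) (HS : semigroup S) (Gamma gamma : R).
Context (HGamma : 1 <= Gamma) (Hgamma : 0 < gamma).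
Context (Hstable : forall t (x : V), 0 <= t ->
  norm (S t x) <= Gamma * exp (- gamma * t) * norm x).

(** An equivalent norm that absorbs the constant [Gamma]: iterating the
    original bound over successive sampling intervals would produce powers of
    [Gamma]. *)
Definition adapted_norm (x : V) : R :=
  real (Lub_Rbar (fun r => exists s, 0 <= s /\ r = exp (gamma * s) * norm (S s x))).

Lemma exp_cancel s : exp (gamma * s) * exp (- gamma * s) = 1.
Proof. rewrite <- exp_plus. replace (_ + _) with 0 by ring. apply exp_0. Qed.

Lemma adapted_term_le s (x : V) : 0 <= s ->
  exp (gamma * s) * norm (S s x) <= Gamma * norm x.
Proof.
  intros Hs. pose proof (exp_pos (gamma * s)) as Hpos.
  apply Rle_trans with (exp (gamma * s) * (Gamma * exp (- gamma * s) * norm x)).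
  - apply Rmult_le_compat_l; [lra|]. now apply Hstable.
  - replace (exp (gamma * s) * (Gamma * exp (- gamma * s) * norm x))
      with (exp (gamma * s) * exp (- gamma * s) * (Gamma * norm x)) by ring.
    rewrite exp_cancel. lra.
Qed.

Lemma adapted_norm_lub (x : V) :
  is_lub_Rbar (fun r => exists s, 0 <= s /\ r = exp (gamma * s) * norm (S s x))
    (Finite (adapted_norm x)).
Proof.
  set (E := fun r => exists s, 0 <= s /\ r = exp (gamma * s) * norm (S s x)).
  change (is_lub_Rbar E (Finite (real (Lub_Rbar E)))).
  pose proof (Lub_Rbar_correct E) as HL.
  destruct (Lub_Rbar E) as [l| |]; [exact HL| |].
  - exfalso. destruct HL as [_ HL]. apply (HL (Finite (Gamma * norm x))).
    intros r [s [Hs ->]]. now apply adapted_term_le.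
  - exfalso. destruct HL as [HL _].
    apply (HL (exp (gamma * 0) * norm (S 0 x))).
    exists 0. split; [lra|reflexivity].
Qed.

Lemma adapted_norm_ge s (x : V) : 0 <= s ->
  exp (gamma * s) * norm (S s x) <= adapted_norm x.
Proof.
  intros Hs. apply (proj1 (adapted_norm_lub x)). now exists s.
Qed.

Lemma adapted_norm_le (x : V) M :
  (forall s, 0 <= s -> exp (gamma * s) * norm (S s x) <= M) ->
  adapted_norm x <= M.
Proof.
  intros HM. apply (proj2 (adapted_norm_lub x) (Finite M)).
  intros r [s [Hs ->]]. now apply HM.
Qed.

Lemma norm_le_adapted (x : V) : norm x <= adapted_norm x.
Proof.
  pose proof (adapted_norm_ge 0 x (Rle_refl 0)) as H.
  rewrite Rmult_0_r, exp_0, Rmult_1_l, (sg_zero S HS) in H. exact H.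
Qed.

Lemma adapted_le_norm (x : V) : adapted_norm x <= Gamma * norm x.
Proof. apply adapted_norm_le. intros s Hs. now apply adapted_term_le. Qed.

Lemma adapted_norm_plus (x y : V) :
  adapted_norm (plus x y) <= adapted_norm x + adapted_norm y.
Proof.
  apply adapted_norm_le. intros s Hs.
  rewrite (lin_plus (S s)) by now apply HS.
  pose proof (exp_pos (gamma * s)).
  apply Rle_trans with (exp (gamma * s) * (norm (S s x) + norm (S s y))).
  - apply Rmult_le_compat_l; [lra|]. apply norm_plus_le.
  - pose proof (adapted_norm_ge s x Hs). pose proof (adapted_norm_ge s y Hs). lra.
Qed.

Lemma adapted_norm_contract h (x : V) : 0 <= h ->
  adapted_norm (S h x) <= exp (- gamma * h) * adapted_norm x.
Proof.
  intros Hh. apply adapted_norm_le. intros s Hs.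
  rewrite <- (sg_add S HS) by assumption.
  pose proof (adapted_norm_ge (s + h) x ltac:(lra)) as H.
  apply (Rmult_le_compat_l (exp (- gamma * h))) in H;
    [|apply Rlt_le, exp_pos].
  apply Rle_trans with (2 := H). right.
  replace (gamma * (s + h)) with (gamma * s + gamma * h) by ring.
  rewrite exp_plus.
  replace (exp (- gamma * h) * (exp (gamma * s) * exp (gamma * h) * norm (S (s + h) x)))
    with (exp (gamma * h) * exp (- gamma * h)
            * (exp (gamma * s) * norm (S (s + h) x))) by ring.
  rewrite exp_cancel. ring.
Qed.

Lemma adapted_norm_lipschitz (x y : V) :
  Rabs (adapted_norm x - adapted_norm y) <= Gamma * norm (minus x y).
Proof.
  assert (H : forall u v : V, adapted_norm u <= adapted_norm v + Gamma * norm (minus u v)).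
  { intros u v. replace u with (plus v (minus u v)) at 1 by vec_in V.
    apply Rle_trans with (1 := adapted_norm_plus _ _).
    apply Rplus_le_compat_l, adapted_le_norm. }
  pose proof (H x y) as H1. pose proof (H y x) as H2.
  rewrite (norm_minus_sym y x) in H2. apply Rabs_le. lra.
Qed.

Context (T : R -> V -> V) (HT : semigroup T).
Context (E : V -> V) (HE : is_linear E).
Context (HTS : forall x y, right_deriv T x y ->
  exists b, right_deriv T x b /\ right_deriv S x (plus b (E x))).
Context (y f : R -> V) (a : R).
Context (Hf : forall s, continuous f s).
Context (Hy : forall t, 0 <= t <= a ->
  y t = plus (T t (y 0)) (RInt (fun s => T (t - s) (f s)) 0 t)).

Lemma adapted_norm_dini s m : 0 <= s < a ->
  norm (minus (f s) (E (y s))) <= m ->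
  dini_le (fun r => adapted_norm (y r)) s (- gamma * adapted_norm (y s) + Gamma * m).
Proof.
  intros Hs Hm e He.
  destruct (mild_increment T HT y f a Hf Hy S E HS HE HTS s (e / 2 / Gamma) Hs)
    as [d1 [Hd1 H1]]; [repeat apply Rdiv_lt_0_compat; lra|].
  assert (HN : 0 <= adapted_norm (y s)).
  { apply Rle_trans with (2 := norm_le_adapted (y s)). apply norm_ge_0. }
  destruct (exp_neg_le gamma (adapted_norm (y s)) (e / 2) Hgamma HN)
    as [d2 [Hd2 H2]]; [lra|].
  exists (Rmin d1 d2). split; [now apply Rmin_pos|]. intros h Hh.
  pose proof (Rmin_l d1 d2). pose proof (Rmin_r d1 d2).
  destruct (H1 h ltac:(lra)) as [_ H1h]. specialize (H2 h ltac:(lra)).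
  set (z := scal h (minus (f s) (E (y s)))) in *.
  set (w := plus (S h (y s)) z) in *.
  pose proof (adapted_norm_lipschitz (y (s + h)) w) as Hlip.
  apply Rabs_le_between in Hlip. destruct Hlip as [_ Hlip].
  pose proof (adapted_norm_plus (S h (y s)) z) as Hplus. fold w in Hplus.
  pose proof (adapted_norm_contract h (y s) ltac:(lra)) as Hcon.
  pose proof (adapted_le_norm z) as Hz. unfold z in Hz at 2.
  rewrite (norm_scal_pos h) in Hz by lra.
  apply (Rmult_le_compat_l Gamma) in H1h; [|lra].
  replace (Gamma * (e / 2 / Gamma * h)) with (e / 2 * h) in H1h by (field; lra).
  assert (Gamma * (h * norm (minus (f s) (E (y s)))) <= Gamma * (h * m)).
  { apply Rmult_le_compat_l; [lra|]. apply Rmult_le_compat_l; lra. }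
  lra.
Qed.

End AdaptedNorm.

(** * Hilbert spaces and compact operators *)

Record inner_product {V : CompleteNormedModule R_AbsRing} (ip : V -> V -> R) : Prop := {
  ip_plus_l : forall x y z, ip (plus x y) z = ip x z + ip y z;
  ip_scal_l : forall r x y, ip (scal r x) y = r * ip x y;
  ip_sym : forall x y, ip x y = ip y x;
  ip_norm : forall x : V, ip x x = norm x ^ 2
}.

Section Hilbert.

Context {V : CompleteNormedModule R_AbsRing} (ip : V -> V -> R).
Context (Hip : inner_product ip).

Lemma ip_minus_l x y z : ip (minus x y) z = ip x z - ip y z.
Proof.
  replace (minus x y) with (plus x (scal (-1) y)) by vec_in V.
  rewrite (ip_plus_l ip Hip), (ip_scal_l ip Hip). ring.
Qed.

Lemma ip_plus_r x y z : ip x (plus y z) = ip x y + ip x z.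
Proof. rewrite !(ip_sym ip Hip x). apply Hip. Qed.

Lemma ip_scal_r r x y : ip x (scal r y) = r * ip x y.
Proof. rewrite !(ip_sym ip Hip x). apply Hip. Qed.

Lemma ip_minus_r x y z : ip x (minus y z) = ip x y - ip x z.
Proof. rewrite !(ip_sym ip Hip x). apply ip_minus_l. Qed.

Lemma norm_sq_plus (x y : V) :
  norm (plus x y) ^ 2 = norm x ^ 2 + 2 * ip x y + norm y ^ 2.
Proof.
  rewrite <- !(ip_norm ip Hip), (ip_plus_l ip Hip), !ip_plus_r.
  rewrite (ip_sym ip Hip y x). ring.
Qed.

Lemma norm_sq_minus (x y : V) :
  norm (minus x y) ^ 2 = norm x ^ 2 - 2 * ip x y + norm y ^ 2.
Proof.
  rewrite <- !(ip_norm ip Hip), ip_minus_l, !ip_minus_r.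
  rewrite (ip_sym ip Hip y x). ring.
Qed.

Lemma ip_le (x y : V) : ip x y <= norm x * norm y.
Proof.
  pose proof (norm_sq_minus x y) as H.
  pose proof (norm_le_minus x y) as H1. pose proof (norm_le_minus y x) as H2.
  rewrite (norm_minus_sym y x) in H2.
  pose proof (norm_ge_0 (minus x y)).
  assert ((norm x - norm y) ^ 2 <= norm (minus x y) ^ 2); [|nra].
  rewrite <- (Rsqr_pow2 (norm x - norm y)), <- Rsqr_pow2.
  apply Rsqr_le_abs_1. rewrite (Rabs_right (norm (minus x y))) by lra.
  apply Rabs_le. lra.
Qed.

Lemma cauchy_schwarz (x y : V) : Rabs (ip x y) <= norm x * norm y.
Proof.
  apply Rabs_le. split; [|apply ip_le].
  pose proof (ip_le (scal (-1) x) y) as H.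
  rewrite (ip_scal_l ip Hip), norm_scal_eq in H.
  rewrite (Rabs_left (-1)) in H; lra.
Qed.

(** Both the representation of functionals and orthogonal projections are
    obtained from this lemma by maximizing [2 g x - norm x ^ 2] on the closed
    subspace [M]: near-maximizers are close to each other by the parallelogram
    law. *)
Lemma riesz_subspace (M : V -> Prop) (g : V -> R) (C : R) :
  M zero ->
  (forall x y, M x -> M y -> M (plus x y)) ->
  (forall r x, M x -> M (scal r x)) ->
  (forall x : V, (forall e, 0 < e -> exists m, M m /\ norm (minus m x) < e) -> M x) ->
  (forall x y, g (plus x y) = g x + g y) ->
  (forall r x, g (scal r x) = r * g x) ->
  (forall x : V, g x <= C * norm x) ->
  exists p, M p /\ forall m, M m -> g m = ip m p.
Proof.
  intros M0 Mplus Mscal Mclosed gplus gscal gbound.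
  set (K := fun x : V => 2 * g x - norm x ^ 2).
  destruct (completeness (fun r => exists m, M m /\ r = K m)) as [s [Hub Hlub]].
  { exists (C ^ 2). intros r [m [_ ->]]. unfold K. specialize (gbound m).
    pose proof (pow2_ge_0 (C - norm m)). nra. }
  { exists (K zero). now exists zero. }
  assert (HKs : forall m, M m -> K m <= s) by (intros m Hm; apply Hub; now exists m).
  assert (Hnear : forall e, 0 < e -> exists m, M m /\ s - e < K m).
  { intros e He. apply NNPP. intros Hn. assert (s <= s - e); [|lra].
    apply Hlub. intros r [m [Hm ->]]. apply Rnot_lt_le. intros Hlt.
    apply Hn. now exists m. }
  assert (Hclose : forall e x y, M x -> M y -> s - e < K x -> s - e < K y ->
            norm (minus x y) ^ 2 < 4 * e).
  { intros e x y Hx Hy HKx HKy.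
    pose proof (HKs (scal (/ 2) (plus x y))
                  (Mscal _ _ (Mplus _ _ Hx Hy))) as Hmid.
    unfold K in *. rewrite gscal, gplus in Hmid.
    rewrite norm_scal_pos in Hmid by lra.
    pose proof (norm_sq_plus x y). pose proof (norm_sq_minus x y). nra. }
  set (F := fun P : V -> Prop => exists e, 0 < e /\
              forall m, M m -> s - e < K m -> P m).
  assert (HF : ProperFilter F).
  { split.
    - intros P [e [He HP]]. destruct (Hnear e He) as [m [Hm HK]].
      exists m. now apply HP.
    - split.
      + exists 1. split; [lra|easy].
      + intros P Q [e1 [He1 HP]] [e2 [He2 HQ]].
        exists (Rmin e1 e2). split; [now apply Rmin_pos|]. intros m Hm HK.
        pose proof (Rmin_l e1 e2). pose proof (Rmin_r e1 e2).
        split; [apply HP|apply HQ]; (assumption || lra).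
      + intros P Q HPQ [e [He HP]]. exists e. split; [assumption|].
        intros m Hm HK. now apply HPQ, HP. }
  assert (Hcauchy : cauchy F).
  { intros eps. pose proof (cond_pos eps) as Heps.
    destruct (Hnear (eps ^ 2 / 4)) as [x [Hx HKx]]; [nra|].
    exists x, (eps ^ 2 / 4). split; [nra|]. intros m Hm HK.
    apply (@norm_compat1 R_AbsRing V).
    pose proof (Hclose (eps ^ 2 / 4) m x Hm Hx HK HKx) as Hd.
    pose proof (norm_ge_0 (minus m x)).
    apply Rnot_le_lt. intros Hle.
    change (pos eps <= norm (minus m x)) in Hle.
    assert (pos eps ^ 2 <= norm (minus m x) ^ 2) by (apply pow_incr; lra).
    lra. }
  pose proof (complete_cauchy F HF Hcauchy) as Hlim.
  set (p := (lim F : V)) in Hlim.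
  assert (Hp : forall e, 0 < e -> exists d, 0 < d /\
            forall m, M m -> s - d < K m -> norm (minus m p) < e).
  { intros e He.
    pose proof (@norm_factor_gt_0 R_AbsRing V) as Hnf.
    assert (Hq : 0 < e / @norm_factor R_AbsRing V)
      by now apply Rdiv_lt_0_compat.
    destruct (Hlim (mkposreal _ Hq)) as [d [Hd HP]].
    exists d. split; [assumption|]. intros m Hm HK.
    pose proof (@norm_compat2 R_AbsRing V p m (mkposreal _ Hq) (HP m Hm HK)) as Hn.
    simpl in Hn.
    replace (norm_factor * (e / norm_factor)) with e in Hn by (field; lra).
    exact Hn. }
  exists p. split.
  - apply Mclosed. intros e He. destruct (Hp e He) as [d [Hd HP]].
    destruct (Hnear d Hd) as [m [Hm HK]]. exists m. split; [assumption|].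
    now apply HP.
  - intros m Hm. apply Rminus_diag_uniq.
    assert (Habs : Rabs (g m - ip m p) <= 0).
    { apply le_of_small_excess with ((1 + norm m ^ 2) / 2 + norm m).
      intros r Hr. rewrite Rplus_0_l.
      destruct (Hp r Hr) as [d [Hd HP]].
      destruct (Hnear (Rmin d (r ^ 2))) as [x [Hx HK]].
      { apply Rmin_pos; [assumption|nra]. }
      pose proof (Rmin_l d (r ^ 2)). pose proof (Rmin_r d (r ^ 2)).
      specialize (HP x Hx ltac:(lra)).
      assert (Hvar : forall t, 2 * t * (g m - ip x m) <= r ^ 2 + t ^ 2 * norm m ^ 2).
      { intros t. pose proof (HKs (plus x (scal t m))
          (Mplus _ _ Hx (Mscal t m Hm))) as Ht.
        unfold K in *. rewrite gplus, gscal, norm_sq_plus, ip_scal_r in Ht.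
        rewrite norm_scal_eq, Rpow_mult_distr, pow2_abs in Ht. lra. }
      pose proof (Hvar r) as Hv1. pose proof (Hvar (- r)) as Hv2.
      pose proof (cauchy_schwarz (minus x p) m) as Hcs.
      rewrite ip_minus_l, (ip_sym ip Hip p m) in Hcs.
      pose proof (norm_ge_0 m) as Hm0.
      assert (Hcs2 : Rabs (ip x m - ip m p) <= r * norm m).
      { apply Rle_trans with (1 := Hcs). apply Rmult_le_compat_r; lra. }
      apply Rabs_le_between in Hcs2. destruct Hcs2 as [Hc1 Hc2].
      assert (Hg1 : g m - ip x m <= r * ((1 + norm m ^ 2) / 2)).
      { apply Rmult_le_reg_l with (2 * r); [lra|]. lra. }
      assert (Hg2 : - (g m - ip x m) <= r * ((1 + norm m ^ 2) / 2)).
      { apply Rmult_le_reg_l with (2 * r); [lra|]. lra. }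
      apply Rabs_le. lra. }
    pose proof (Rabs_pos (g m - ip m p)).
    apply Rabs_eq_0. lra.
Qed.

Lemma riesz (g : V -> R) (C : R) :
  (forall x y, g (plus x y) = g x + g y) ->
  (forall r x, g (scal r x) = r * g x) ->
  (forall x : V, g x <= C * norm x) ->
  exists w, forall x, g x = ip x w.
Proof.
  intros g1 g2 g3.
  destruct (riesz_subspace (fun _ => True) g C) as [w [_ Hw]]; try easy.
  exists w. intros x. now apply Hw.
Qed.

Context (T : R -> V -> V) (HT : semigroup T).

(** The orbit of [w] under the adjoint semigroup is continuous at [0] in norm. *)
Definition adjoint_continuous (w : V) : Prop :=
  forall e, 0 < e -> exists d, 0 < d /\ forall h, 0 < h < d ->
    forall x : V, Rabs (ip (minus (T h x) x) w) <= e * norm x.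

Lemma adjoint_continuous_plus u v : adjoint_continuous u ->
  adjoint_continuous v -> adjoint_continuous (plus u v).
Proof.
  intros Hu Hv e He.
  destruct (Hu (e / 2)) as [d1 [Hd1 H1]]; [lra|].
  destruct (Hv (e / 2)) as [d2 [Hd2 H2]]; [lra|].
  exists (Rmin d1 d2). split; [now apply Rmin_pos|]. intros h Hh x.
  pose proof (Rmin_l d1 d2). pose proof (Rmin_r d1 d2).
  specialize (H1 h ltac:(lra) x). specialize (H2 h ltac:(lra) x).
  rewrite ip_plus_r. apply Rle_trans with (1 := Rabs_triang _ _). lra.
Qed.

Lemma adjoint_continuous_scal r u : adjoint_continuous u ->
  adjoint_continuous (scal r u).
Proof.
  intros Hu e He. pose proof (Rabs_pos r).
  destruct (Hu (e / (Rabs r + 1))) as [d [Hd H1]].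
  { apply Rdiv_lt_0_compat; lra. }
  exists d. split; [assumption|]. intros h Hh x. specialize (H1 h Hh x).
  rewrite ip_scal_r, Rabs_mult.
  set (q := Rabs (ip (minus (T h x) x) u)) in *.
  assert (0 <= q) by apply Rabs_pos.
  apply (Rmult_le_compat_l (Rabs r + 1)) in H1; [|lra].
  replace ((Rabs r + 1) * (e / (Rabs r + 1) * norm x)) with (e * norm x) in H1
    by (field; lra).
  nra.
Qed.

Lemma adjoint_continuous_closed (w : V) :
  (forall e, 0 < e -> exists m, adjoint_continuous m /\ norm (minus m w) < e) ->
  adjoint_continuous w.
Proof.
  intros Hw e He. destruct (sg_bound T HT 1) as [M [HM Hb]].
  set (e1 := e / 2 / (M + 1)).
  assert (He1 : 0 < e1) by (repeat apply Rdiv_lt_0_compat; lra).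
  destruct (Hw e1 He1) as [m [Hm Hmw]].
  destruct (Hm (e / 2)) as [d [Hd H1]]; [lra|].
  exists (Rmin d 1). split; [apply Rmin_pos; lra|]. intros h Hh x.
  pose proof (Rmin_l d 1). pose proof (Rmin_r d 1).
  specialize (H1 h ltac:(lra) x). specialize (Hb h x ltac:(lra)).
  pose proof (norm_minus_le (T h x) x) as Hn.
  set (z := minus (T h x) x) in *.
  pose proof (cauchy_schwarz z (minus m w)) as Hcs.
  rewrite ip_minus_r in Hcs.
  pose proof (norm_ge_0 x) as Hx.
  assert (norm z * norm (minus m w) <= (M + 1) * norm x * e1).
  { apply Rmult_le_compat; [apply norm_ge_0|apply norm_ge_0|lra|lra]. }
  assert (He1' : (M + 1) * norm x * e1 = e / 2 * norm x)
    by (unfold e1; field; lra).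
  replace (ip z w) with (ip z m - (ip z m - ip z w)) by ring.
  apply Rle_trans with (1 := Rabs_triang _ _). rewrite Rabs_Ropp. lra.
Qed.

(** The vector [v] is [d] times the average over [[0, d]] of the adjoint orbit
    of [w]; it is norm-continuous because [orbit_integral T d] turns the
    difference [T h x - x] into an integral over the short interval [[0, h]]. *)
Lemma adjoint_average (w : V) (d : R) : 0 < d ->
  exists v, adjoint_continuous v /\
    forall x, ip (orbit_integral T d x) w = ip x v.
Proof.
  intros Hd.
  pose proof (orbit_integral_linear T HT d ltac:(lra)) as HQ.
  destruct (riesz (fun x => ip (orbit_integral T d x) w)
              (op_norm (orbit_integral T d) * norm w)) as [v Hv].
  - intros x y. rewrite (lin_plus _ _ _ HQ). apply Hip.
  - intros r x. rewrite (lin_scal _ _ _ HQ). apply Hip.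
  - intros x. apply Rle_trans with (1 := ip_le _ _).
    pose proof (op_norm_bound (orbit_integral T d) x HQ).
    pose proof (norm_ge_0 w). nra.
  - exists v. split; [|exact Hv]. intros e He.
    destruct (sg_bound T HT (d + 1)) as [M [HM Hb]].
    pose proof (norm_ge_0 w) as Hw0.
    set (c := (M + 1) * M * (norm w + 1)).
    assert (Hc : 0 < c) by (unfold c; repeat apply Rmult_lt_0_compat; lra).
    exists (Rmin 1 (e / c)).
    split; [apply Rmin_pos; [lra|now apply Rdiv_lt_0_compat]|].
    intros h Hh x. pose proof (Rmin_l 1 (e / c)). pose proof (Rmin_r 1 (e / c)).
    rewrite <- Hv, (lin_minus _ _ _ HQ).
    rewrite (orbit_integral_comm T HT), (orbit_integral_swap T HT) by lra.
    apply Rle_trans with (1 := cauchy_schwarz _ _).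
    assert (Hq : norm (orbit_integral T h x) <= (h - 0) * (M * norm x)).
    { apply norm_RInt_bound; [lra|apply (ex_RInt_orbit T HT); lra|].
      intros s Hs. apply Hb. lra. }
    set (z := orbit_integral T h x) in *.
    assert (Hz : norm (minus (T d z) z) <= (M + 1) * norm z).
    { apply Rle_trans with (1 := norm_minus_le _ _).
      specialize (Hb d z ltac:(lra)). lra. }
    pose proof (norm_ge_0 x) as Hx.
    apply Rle_trans with ((M + 1) * (h * (M * norm x)) * (norm w + 1)).
    { apply Rmult_le_compat; [apply norm_ge_0|assumption| |lra].
      apply Rle_trans with (1 := Hz). apply Rmult_le_compat_l; lra. }
    replace ((M + 1) * (h * (M * norm x)) * (norm w + 1))
      with (h * c * norm x) by (unfold c; ring).
    apply Rmult_le_compat_r; [assumption|].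
    assert (Hhc : h <= e / c) by lra.
    apply (Rmult_le_compat_r c) in Hhc; [|lra].
    replace (e / c * c) with e in Hhc by (field; lra). exact Hhc.
Qed.

(** The averages of an adjoint orbit converge to its starting point weakly,
    so a vector orthogonal to all of them is orthogonal to that point. The
    vectors of norm-continuity form a closed subspace containing the averages,
    and the component of [w] orthogonal to it must vanish. *)
Lemma adjoint_strongly_continuous (w : V) : adjoint_continuous w.
Proof.
  destruct (riesz_subspace adjoint_continuous (fun x => ip x w) (norm w))
    as [p [Hp Hpm]].
  - intros e He. exists 1. split; [lra|]. intros h Hh x.
    replace (zero : V) with (scal 0 w) by vec_in V.
    rewrite ip_scal_r, Rmult_0_l, Rabs_R0. pose proof (norm_ge_0 x). nra.
  - intros x y. apply adjoint_continuous_plus.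
  - intros r x. apply adjoint_continuous_scal.
  - apply adjoint_continuous_closed.
  - intros x y. apply Hip.
  - intros r x. apply Hip.
  - intros x. rewrite Rmult_comm. apply ip_le.
  - set (v := minus w p).
    assert (Horth : forall m, adjoint_continuous m -> ip m v = 0).
    { intros m Hm. unfold v. rewrite ip_minus_r, (Hpm m Hm). ring. }
    assert (Hvw : Rabs (ip v w) <= 0).
    { apply le_of_small_excess with (norm w). intros e He. rewrite Rplus_0_l.
      destruct (orbit_integral_deriv T HT v e He) as [c [Hc Hq]].
      set (h := c / 2). assert (Hh : 0 < h < c) by (unfold h; lra).
      specialize (Hq h Hh).
      destruct (adjoint_average w h ltac:(lra)) as [u [Hu Hui]].
      pose proof (cauchy_schwarz (minus (orbit_integral T h v) (scal h v)) w) as Hcs.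
      rewrite ip_minus_l, (ip_scal_l ip Hip), Hui, (ip_sym ip Hip v u) in Hcs.
      rewrite (Horth u Hu) in Hcs.
      replace (0 - h * ip v w) with (- (h * ip v w)) in Hcs by ring.
      rewrite Rabs_Ropp, Rabs_mult, (Rabs_right h) in Hcs by lra.
      apply Rmult_le_reg_l with h; [lra|].
      apply Rle_trans with (1 := Hcs).
      apply (Rmult_le_compat_r (norm w)) in Hq; [|apply norm_ge_0]. lra. }
    assert (Hv0 : norm v ^ 2 = 0).
    { rewrite <- (ip_norm ip Hip). unfold v at 2. rewrite ip_minus_r.
      rewrite (ip_sym ip Hip v p), (Horth p Hp).
      pose proof (Rabs_pos (ip v w)).
      assert (ip v w = 0) by (apply Rabs_eq_0; lra). lra. }
    assert (Hv1 : norm v = 0) by (pose proof (norm_ge_0 v); nra).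
    apply (@norm_eq_zero R_AbsRing V) in Hv1.
    replace w with p; [exact Hp|].
    replace w with (plus p v) by (unfold v; vec_in V). rewrite Hv1. vec_in V.
Qed.

End Hilbert.

Section CompactOperators.

Context {V W : CompleteNormedModule R_AbsRing}.
Context (ipV : V -> V -> R) (ipW : W -> W -> R).
Context (HV : inner_product ipV) (HW : inner_product ipW).
Context (F : V -> W) (HF : compact_operator F).
Context (T : R -> V -> V) (HT : semigroup T).

Lemma compact_operator_net e : 0 < e ->
  exists l : list W, forall x : V, norm x <= 1 ->
    exists z, In z l /\ norm (minus (F x) z) <= e.
Proof.
  intros He. destruct HF as [_ Hcomp].
  destruct (Hcomp W (fun z y : W => norm (minus y z) < e)) as [l Hl].
  - intros z. change (forall y : W, norm (minus y z) < e ->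
      locally y (fun y : W => norm (minus y z) < e)). intros y Hy.
    apply (@locally_le_locally_norm R_AbsRing W).
    assert (Hpos : 0 < e - norm (minus y z)) by lra.
    exists (mkposreal _ Hpos).
    change (forall u : W, norm (minus u y) < e - norm (minus y z) ->
      norm (minus u z) < e). intros u Hu.
    apply Rle_lt_trans with (1 := norm_minus_triangle u y z). lra.
  - intros y _. exists y. rewrite (norm_minus_self (y : W)). assumption.
  - exists l. intros x Hx. destruct (Hl (F x)) as [z [Hz Hd]].
    + intros O _ HO. exists (F x). split; [assumption|]. now exists x.
    + exists z. split; [assumption|lra].
Qed.

(** For a single [z] this is the norm continuity of the adjoint orbit of the
    vector representing [x |-> ip (F x) z]. *)
Lemma weak_uniform_continuity (l : list W) e : 0 < e ->
  exists d, 0 < d /\ forall h, 0 < h < d -> forall z, In z l -> forall x : V,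
    Rabs (ipW (F (minus (T h x) x)) z) <= e * norm x.
Proof.
  intros He. destruct HF as [HFl _]. induction l as [|z l [d1 [Hd1 H1]]].
  - exists 1. split; [lra|]. now intros h _ z [].
  - destruct (riesz ipV HV (fun x => ipW (F x) z) (op_norm F * norm z)) as [w Hw].
    + intros x y. rewrite (lin_plus F) by assumption. apply HW.
    + intros r x. rewrite (lin_scal F) by assumption. apply HW.
    + intros x. apply Rle_trans with (1 := ip_le ipW HW _ _).
      pose proof (op_norm_bound F x HFl). pose proof (norm_ge_0 z). nra.
    + destruct (adjoint_strongly_continuous ipV HV T HT w e He) as [d2 [Hd2 H2]].
      exists (Rmin d1 d2). split; [now apply Rmin_pos|]. intros h Hh z' Hz' x.
      pose proof (Rmin_l d1 d2). pose proof (Rmin_r d1 d2).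
      destruct Hz' as [<-|Hz'].
      * rewrite Hw. apply H2. lra.
      * apply H1; [lra|assumption].
Qed.

(** Compactness upgrades weak to norm convergence: if [z] belongs to a finite
    net and is close to the unit-scale vector [F y], then
    [norm (F y) ^ 2 = ip (F y) z + ip (F y) (F y - z)] is small as soon as the
    finitely many pairings [ip (F y) z] are. *)
Lemma compact_semigroup_norm_continuous e : 0 < e ->
  exists d, 0 < d /\ forall h, 0 < h < d -> forall x : V,
    norm (F (minus (T h x) x)) <= e * norm x.
Proof.
  intros He. pose proof (proj1 HF) as HFl.
  destruct (sg_bound T HT 1) as [M [HM Hb]].
  set (e1 := e / 2 / (M + 1)).
  assert (He1 : 0 < e1) by (repeat apply Rdiv_lt_0_compat; lra).
  destruct (compact_operator_net e1 He1) as [l Hl].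
  destruct (weak_uniform_continuity l (e1 ^ 2) ltac:(nra)) as [d [Hd Hw]].
  exists (Rmin d 1). split; [apply Rmin_pos; lra|]. intros h Hh x.
  pose proof (Rmin_l d 1). pose proof (Rmin_r d 1).
  specialize (Hb h x ltac:(lra)).
  pose proof (norm_minus_le (T h x) x) as Hn.
  destruct (Req_dec (norm x) 0) as [Hx0|Hx0].
  - assert (Hz : norm (minus (T h x) x) = 0).
    { pose proof (norm_ge_0 (minus (T h x) x)). rewrite Hx0 in *. lra. }
    pose proof (op_norm_bound F (minus (T h x) x) HFl) as HFb.
    rewrite Hz, Rmult_0_r in HFb. rewrite Hx0. lra.
  - assert (Hx : 0 < norm x) by (pose proof (norm_ge_0 x); lra).
    specialize (Hw h ltac:(lra)).
    set (y := minus (T h x) x) in *.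
    set (c := (M + 1) * norm x). assert (Hc : 0 < c) by (unfold c; nra).
    assert (Hc' : 0 < / c) by now apply Rinv_0_lt_compat.
    destruct (Hl (scal (/ c) y)) as [z [Hz Hzd]].
    { rewrite norm_scal_pos by lra. apply Rmult_le_reg_l with c; [assumption|].
      rewrite <- Rmult_assoc, Rinv_r, Rmult_1_l, Rmult_1_r by lra.
      unfold c. lra. }
    specialize (Hw z Hz x).
    rewrite (lin_scal F) in Hzd by assumption.
    set (v := scal (/ c) (F y)) in *.
    assert (Hvz : Rabs (ipW v z) <= e1 ^ 2).
    { unfold v. rewrite (ip_scal_l ipW HW), Rabs_mult, (Rabs_right (/ c)) by lra.
      apply Rmult_le_reg_l with c; [assumption|].
      rewrite <- Rmult_assoc, Rinv_r, Rmult_1_l by lra.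
      apply Rle_trans with (1 := Hw).
      assert (0 <= e1 ^ 2 * norm x)
        by (apply Rmult_le_pos; [apply pow2_ge_0|lra]).
      unfold c. nra. }
    pose proof (cauchy_schwarz ipW HW v (minus v z)) as Hcs.
    rewrite (ip_minus_r ipW HW), (ip_norm ipW HW) in Hcs.
    apply Rabs_le_between in Hcs, Hvz.
    pose proof (norm_ge_0 v) as Hv0.
    assert (norm v * norm (minus v z) <= norm v * e1)
      by now apply Rmult_le_compat_l.
    assert (Hv : norm v <= 2 * e1) by nra.
    unfold v in Hv. rewrite norm_scal_pos in Hv by lra.
    apply (Rmult_le_compat_l c) in Hv; [|lra].
    rewrite <- Rmult_assoc, Rinv_r, Rmult_1_l in Hv by lra.
    apply Rle_trans with (1 := Hv). right. unfold c, e1. field. lra.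
Qed.

End CompactOperators.

(** * The triggering function *)

Lemma cont_at_continuous (f : R -> R) (s : R) : cont_at f s -> continuous f s.
Proof.
  intros Hf. apply (continuous_norm_iff (V := R_CompleteNormedModule)). exact Hf.
Qed.

Lemma exp_le_compat x y : x <= y -> exp x <= exp y.
Proof. intros [H| ->]; [apply Rlt_le, exp_increasing, H|apply Rle_refl]. Qed.

Section Eta.

Context (Gamma gamma b L eps : R).
Context (HGamma : 1 <= Gamma) (Hgamma : 0 < gamma) (Hb : 0 <= b) (HL : 0 <= L).
Context (Heps : 0 < eps).

Let c := eps * b / gamma.

Lemma eta_weight_ge0 : 0 <= c.
Proof.
  unfold c. apply Rmult_le_pos; [nra|]. apply Rlt_le, Rinv_0_lt_compat, Hgamma.
Qed.

Lemma exp_decay_range s : 0 <= s -> 0 < exp (- gamma * s) <= 1.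
Proof.
  intros Hs. split; [apply exp_pos|]. rewrite <- exp_0.
  apply exp_le_compat. nra.
Qed.

Lemma eta_range s : 0 <= s <= 1 ->
  0 <= eta Gamma gamma b L eps s <= Gamma * exp (Gamma * L) * (1 + c).
Proof.
  intros Hs. unfold eta. fold c. pose proof eta_weight_ge0 as Hc.
  pose proof (exp_decay_range s ltac:(lra)) as Hd.
  pose proof (exp_pos (Gamma * L * s)) as Hp.
  assert (He : exp (Gamma * L * s) <= exp (Gamma * L)).
  { apply exp_le_compat. assert (0 <= Gamma * L) by nra. nra. }
  assert (Hw : 0 <= (1 - c) * exp (- gamma * s) + c <= 1 + c) by nra.
  assert (Hg : 0 <= Gamma * exp (Gamma * L * s)) by nra.
  split; [apply Rmult_le_pos; lra|].
  apply Rmult_le_compat; [assumption|lra| |lra].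
  apply Rmult_le_compat_l; lra.
Qed.

Lemma eta_0 : eta Gamma gamma b L eps 0 = Gamma.
Proof. unfold eta. rewrite !Rmult_0_r, exp_0. ring. Qed.

Lemma eta_derive s :
  is_derive (eta Gamma gamma b L eps) s
    (Gamma * L * eta Gamma gamma b L eps s
      - gamma * (Gamma * exp (Gamma * L * s) * ((1 - c) * exp (- gamma * s)))).
Proof. unfold eta. fold c. auto_derive; [easy|ring]. Qed.

Lemma eta_continuous s : continuous (eta Gamma gamma b L eps) s.
Proof.
  apply (ex_derive_continuous (eta Gamma gamma b L eps)).
  eexists. apply eta_derive.
Qed.

(** As long as the input error is at most [eps] times the initial norm, the
    adapted norm [N] of the state, in units of that initial norm, satisfies
    [N' <= (Gamma * L - gamma) * N + Gamma * b * eps]. The function [eta] is a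
    supersolution of this inequality because [exp (Gamma * L * s) >= 1]. *)
Lemma eta_supersolution s : 0 <= s ->
  (Gamma * L - gamma) * eta Gamma gamma b L eps s + Gamma * b * eps <=
  Gamma * L * eta Gamma gamma b L eps s
    - gamma * (Gamma * exp (Gamma * L * s) * ((1 - c) * exp (- gamma * s))).
Proof.
  intros Hs.
  assert (He : 1 <= exp (Gamma * L * s)).
  { rewrite <- exp_0. apply exp_le_compat. assert (0 <= Gamma * L) by nra. nra. }
  assert (Heta : gamma * eta Gamma gamma b L eps s
    = gamma * (Gamma * exp (Gamma * L * s) * ((1 - c) * exp (- gamma * s)))
      + Gamma * b * eps * exp (Gamma * L * s)).
  { unfold eta. fold c. replace (eps * b) with (c * gamma) in * by (unfold c; field; lra).
    replace (Gamma * b * eps) with (Gamma * (c * gamma)) by (unfold c; field; lra).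
    ring. }
  assert (0 <= Gamma * b * eps)
    by (apply Rmult_le_pos; [apply Rmult_le_pos|]; lra).
  nra.
Qed.

End Eta.

Section Trigger.

Context {V W : CompleteNormedModule R_AbsRing}.
Context (T : R -> V -> V) (HT : semigroup T).
Context (B : W -> V) (F : V -> W) (HB : is_linear B) (HF : is_linear F).
Context (HFT : forall e, 0 < e -> exists d, 0 < d /\ forall h, 0 < h < d ->
  forall x : V, norm (F (minus (T h x) x)) <= e * norm x).
Context (Gamma gamma L eps : R).
Context (HGamma : 1 <= Gamma) (Hgamma : 0 < gamma) (HL : 0 <= L) (Heps : 0 < eps).

Definition gain (t : R) : R := op_norm (fun z : V => F (T t z)).

Lemma gain_linear t : 0 <= t -> is_linear (fun z : V => F (T t z)).
Proof. intros Ht. apply is_linear_comp; [now apply HT|exact HF]. Qed.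

Lemma gain_ge0 t : 0 <= t -> 0 <= gain t.
Proof. intros Ht. apply op_norm_ge0, gain_linear, Ht. Qed.

Lemma gain_bound t M : 0 <= t -> 0 <= M ->
  (forall x : V, norm (T t x) <= M * norm x) -> gain t <= op_norm F * M.
Proof.
  intros Ht HM Hb. pose proof (op_norm_ge0 F HF).
  apply op_norm_le; [now apply gain_linear|now apply Rmult_le_pos|].
  intros x. apply Rle_trans with (1 := op_norm_bound F _ HF).
  rewrite Rmult_assoc. now apply Rmult_le_compat_l.
Qed.

(** Norm continuity of [t |-> F (T t)] follows from that at [0] by the
    semigroup law. *)
Lemma gain_cont s e : 0 <= s -> 0 < e ->
  exists d, 0 < d /\ forall r, 0 <= r -> Rabs (r - s) < d ->
    Rabs (gain r - gain s) < e.
Proof.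
  intros Hs He. destruct (sg_bound T HT (s + 1)) as [M [HM Hb]].
  destruct (HFT (e / 2 / M)) as [d [Hd Hq]].
  { repeat apply Rdiv_lt_0_compat; lra. }
  assert (Hstep : forall p q, 0 <= p -> p < q -> q <= s + 1 -> q - p < d ->
            Rabs (gain q - gain p) <= e / 2).
  { intros p q Hp Hpq Hq1 Hqd.
    apply op_norm_lipschitz; [apply gain_linear; lra|apply gain_linear; lra|lra|].
    intros x. replace (T q x) with (T (q - p) (T p x))
      by (rewrite <- (sg_add T HT) by lra; f_equal; ring).
    rewrite <- (lin_minus F) by assumption.
    apply Rle_trans with (1 := Hq (q - p) ltac:(lra) (T p x)).
    specialize (Hb p x ltac:(lra)).
    apply (Rmult_le_compat_l (e / 2 / M)) in Hb;
      [|apply Rlt_le; repeat apply Rdiv_lt_0_compat; lra].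
    replace (e / 2 / M * (M * norm x)) with (e / 2 * norm x) in Hb
      by (field; lra).
    exact Hb. }
  exists (Rmin d 1). split; [apply Rmin_pos; lra|]. intros r Hr Hrs.
  pose proof (Rmin_l d 1). pose proof (Rmin_r d 1).
  apply Rabs_def2 in Hrs.
  destruct (Rtotal_order r s) as [Hlt|[->|Hgt]].
  - rewrite Rabs_minus_sym. specialize (Hstep r s Hr Hlt ltac:(lra) ltac:(lra)).
    lra.
  - rewrite Rminus_diag, Rabs_R0. assumption.
  - specialize (Hstep s r Hs Hgt ltac:(lra) ltac:(lra)). lra.
Qed.

Lemma gain_clamped_continuous t s :
  continuous (fun r => gain (Rmax 0 (t - r))) s.
Proof.
  apply cont_at_continuous. intros e He.
  destruct (gain_cont (Rmax 0 (t - s)) e (Rmax_l _ _) He) as [d [Hd Hq]].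
  destruct (cont_at_clamp t s d Hd) as [c [Hc Hr]].
  exists c. split; [assumption|]. intros r Hrc.
  apply Hq; [apply Rmax_l|now apply Hr].
Qed.

Lemma ex_RInt_gain t : 0 <= t ->
  ex_RInt (fun s => gain (t - s) * eta Gamma gamma (op_norm B) L eps s) 0 t.
Proof.
  intros Ht.
  apply (ex_RInt_ext (V := R_NormedModule)
    (fun s => gain (Rmax 0 (t - s)) * eta Gamma gamma (op_norm B) L eps s)).
  - rewrite Rmin_left, Rmax_right by assumption. intros s Hs.
    now rewrite Rmax_right by lra.
  - apply (ex_RInt_cont (V := R_CompleteNormedModule)). intros s.
    apply (continuous_mult (fun r => gain (Rmax 0 (t - r)))).
    + apply gain_clamped_continuous.
    + now apply eta_continuous.
Qed.

(** On the realifications of complex spaces this is definitionally [alpha]. *)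
Definition real_alpha (xi : V) (tau : R) : R :=
  norm (F (minus xi (plus (T tau xi) (RInt (fun s => T s (B (F xi))) 0 tau)))) +
  L * RInt (fun s => gain (tau - s) * eta Gamma gamma (op_norm B) L eps s) 0 tau
    * norm xi.

(** Both parts of [real_alpha] vanish as [tau] tends to [0], uniformly for [xi]
    in the unit ball; for the first part this is the norm continuity of
    [t |-> F (T t)] at [0]. *)
Lemma real_alpha_small :
  exists theta, 0 < theta /\ forall (xi : V) tau, 0 < tau < theta ->
    xi <> zero -> real_alpha xi tau < eps * norm xi.
Proof.
  destruct (HFT (eps / 3)) as [d [Hd Hq]]; [lra|].
  destruct (sg_bound T HT 1) as [M [HM HbT]].
  pose proof (op_norm_ge0 B HB) as Hb0. pose proof (op_norm_ge0 F HF) as Hf0.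
  set (b := op_norm B) in *. set (f := op_norm F) in *.
  set (H := Gamma * exp (Gamma * L) * (1 + eps * b / gamma)).
  assert (HH : 0 <= H).
  { pose proof (eta_range Gamma gamma b L eps HGamma Hgamma Hb0 HL Heps 0 ltac:(lra)).
    unfold H. lra. }
  set (K := f * (M * (b * f)) + L * (f * M * H)).
  assert (HK1 : 0 <= f * (M * (b * f))) by (repeat apply Rmult_le_pos; lra).
  assert (HK2 : 0 <= L * (f * M * H)).
  { apply Rmult_le_pos; [lra|]. apply Rmult_le_pos; [nra|exact HH]. }
  assert (HK : 0 <= K) by (unfold K; lra).
  exists (Rmin d (Rmin 1 (eps / 3 / (K + 1)))).
  split; [repeat apply Rmin_pos; try lra; repeat apply Rdiv_lt_0_compat; lra|].
  intros xi tau Htau Hxi.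
  pose proof (Rmin_l d (Rmin 1 (eps / 3 / (K + 1)))).
  pose proof (Rmin_r d (Rmin 1 (eps / 3 / (K + 1)))).
  pose proof (Rmin_l 1 (eps / 3 / (K + 1))).
  pose proof (Rmin_r 1 (eps / 3 / (K + 1))).
  assert (Hn : 0 < norm xi).
  { pose proof (norm_ge_0 xi). destruct (Req_dec (norm xi) 0) as [Hz|Hz]; [|lra].
    now apply (@norm_eq_zero R_AbsRing V) in Hz. }
  assert (Hint1 : norm (RInt (fun s => T s (B (F xi))) 0 tau)
                  <= (tau - 0) * (M * (b * (f * norm xi)))).
  { apply norm_RInt_bound; [lra|apply (ex_RInt_orbit T HT); lra|].
    intros s Hs. apply Rle_trans with (1 := HbT s _ ltac:(lra)).
    apply Rmult_le_compat_l; [lra|].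
    apply Rle_trans with (1 := op_norm_bound B _ HB).
    apply Rmult_le_compat_l; [lra|]. now apply op_norm_bound. }
  set (J := RInt (fun s => T s (B (F xi))) 0 tau) in *.
  assert (Hfirst : norm (F (minus xi (plus (T tau xi) J)))
            <= eps / 3 * norm xi + f * (tau * (M * (b * (f * norm xi))))).
  { replace (minus xi (plus (T tau xi) J))
      with (minus (opp J) (minus (T tau xi) xi)) by vec_in V.
    rewrite (lin_minus F) by assumption.
    apply Rle_trans with (1 := norm_minus_le _ _).
    specialize (Hq tau ltac:(lra) xi).
    pose proof (op_norm_bound F (opp J) HF) as HJ. fold f in HJ.
    rewrite (norm_neg J) in HJ.
    assert (f * norm J <= f * (tau * (M * (b * (f * norm xi)))))
      by (apply Rmult_le_compat_l; lra).
    lra. }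
  assert (Hint2 : Rabs (RInt (fun s => gain (tau - s) * eta Gamma gamma b L eps s) 0 tau)
                  <= (tau - 0) * (f * M * H)).
  { apply (norm_RInt_bound (V := R_CompleteNormedModule)); [lra| |].
    - apply ex_RInt_gain. lra.
    - intros s Hs.
      pose proof (eta_range Gamma gamma b L eps HGamma Hgamma Hb0 HL Heps s
        ltac:(lra)) as Heta.
      pose proof (gain_ge0 (tau - s) ltac:(lra)).
      pose proof (gain_bound (tau - s) M ltac:(lra) ltac:(lra)
        (fun x => HbT (tau - s) x ltac:(lra))) as Hgb.
      change (Rabs (gain (tau - s) * eta Gamma gamma b L eps s) <= f * M * H).
      rewrite Rabs_right by (apply Rle_ge, Rmult_le_pos; lra).
      apply Rmult_le_compat; [lra|apply Heta|exact Hgb|exact (proj2 Heta)]. }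
  apply Rabs_le_between in Hint2. destruct Hint2 as [_ Hint2].
  unfold real_alpha. fold J. fold b.
  set (I := RInt (fun s => gain (tau - s) * eta Gamma gamma b L eps s) 0 tau) in *.
  assert (HLI : L * I * norm xi <= L * (tau * (f * M * H)) * norm xi).
  { apply Rmult_le_compat_r; [lra|]. apply Rmult_le_compat_l; lra. }
  assert (HtK : tau * (K + 1) < eps / 3).
  { apply Rlt_le_trans with (eps / 3 / (K + 1) * (K + 1)).
    - apply Rmult_lt_compat_r; lra.
    - right. field. lra. }
  assert (Htot : f * (tau * (M * (b * (f * norm xi)))) + L * (tau * (f * M * H)) * norm xi
                 = tau * K * norm xi) by (unfold K; ring).
  assert (tau * K * norm xi <= eps / 3 * norm xi).
  { apply Rmult_le_compat_r; lra. }
  assert (0 < eps * norm xi) by (apply Rmult_lt_0_compat; lra).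
  lra.
Qed.

Context (phi : V -> V).
Context (phi_zero : phi zero = zero).
Context (phi_lip : forall x y : V, norm (minus (phi x) (phi y)) <= L * norm (minus x y)).

Lemma phi_bound (x : V) : norm (phi x) <= L * norm x.
Proof.
  apply Rle_trans with (norm (minus (phi x) (phi zero))).
  - right. f_equal. rewrite phi_zero. vec_in V.
  - apply Rle_trans with (1 := phi_lip x zero). right. do 2 f_equal. vec_in V.
Qed.

Lemma phi_continuous (y : R -> V) s : continuous y s ->
  continuous (fun r => phi (y r)) s.
Proof.
  intros Hy. apply continuous_norm_iff. intros e He.
  destruct (proj1 (continuous_norm_iff y s) Hy (e / (L + 1))) as [d [Hd Hq]].
  { apply Rdiv_lt_0_compat; lra. }
  exists d. split; [assumption|]. intros r Hr. specialize (Hq r Hr).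
  apply Rle_lt_trans with (1 := phi_lip _ _).
  pose proof (norm_ge_0 (minus (y r) (y s))).
  apply (Rmult_lt_compat_r (L + 1)) in Hq; [|lra].
  replace (e / (L + 1) * (L + 1)) with e in Hq by (field; lra). nra.
Qed.

Context (y : R -> V) (a : R) (Hyc : forall s, continuous y s).
Context (Hy : forall t, 0 <= t <= a ->
  y t = plus (T t (y 0))
    (RInt (fun s => T (t - s) (plus (B (F (y 0))) (phi (y s)))) 0 t)).

(** The triggering function dominates the input error as long as [eta]
    dominates the state. *)
Lemma input_error_le_alpha tau : 0 <= tau <= a ->
  (forall s, 0 <= s <= tau ->
     norm (y s) <= eta Gamma gamma (op_norm B) L eps s * norm (y 0)) ->
  norm (F (minus (y 0) (y tau))) <= real_alpha (y 0) tau.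
Proof.
  intros Htau Hs.
  set (u := B (F (y 0))).
  assert (Hex1 : ex_RInt (fun s => T (tau - s) u) 0 tau).
  { apply (ex_RInt_convolution T HT (fun _ => u)); [|lra|lra].
    intros s. apply continuous_const. }
  assert (Hex2 : ex_RInt (fun s => T (tau - s) (phi (y s))) 0 tau).
  { apply (ex_RInt_convolution T HT (fun s => phi (y s))); [|lra|lra].
    intros s. now apply phi_continuous. }
  assert (Hsplit : RInt (fun s => T (tau - s) (plus u (phi (y s)))) 0 tau
    = plus (RInt (fun s => T s u) 0 tau)
        (RInt (fun s => T (tau - s) (phi (y s))) 0 tau)).
  { transitivity (RInt (fun s => plus (T (tau - s) u) (T (tau - s) (phi (y s)))) 0 tau).
    - apply (RInt_ext (V := V)). rewrite Rmin_left, Rmax_right by lra.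
      intros s Hr. apply lin_plus, HT. lra.
    - etransitivity; [exact (RInt_plus _ _ 0 tau Hex1 Hex2)|]. f_equal.
      apply is_RInt_unique, (is_RInt_reflect (fun s => T s u)).
      apply (RInt_correct (V := V)), (ex_RInt_orbit T HT); lra. }
  assert (Hyt := Hy tau Htau). fold u in Hyt. rewrite Hsplit in Hyt.
  set (J := RInt (fun s => T (tau - s) (phi (y s))) 0 tau) in *.
  replace (minus (y 0) (y tau)) with
    (minus (minus (y 0) (plus (T tau (y 0)) (RInt (fun s => T s u) 0 tau))) J)
    by (rewrite Hyt; vec_in V).
  rewrite (lin_minus F) by assumption.
  apply Rle_trans with (1 := norm_minus_le _ _).
  unfold real_alpha. fold u. apply Rplus_le_compat_l.
  unfold J. rewrite <- (RInt_linear F) by assumption.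
  set (g := fun s => gain (tau - s) * eta Gamma gamma (op_norm B) L eps s).
  pose proof (ex_RInt_gain tau ltac:(lra)) as Hg. fold g in Hg.
  replace (L * RInt g 0 tau * norm (y 0))
    with (RInt (fun s => (L * norm (y 0)) * g s) 0 tau).
  2:{ transitivity ((L * norm (y 0)) * RInt g 0 tau).
      - exact (RInt_scal (V := R_CompleteNormedModule) g 0 tau (L * norm (y 0)) Hg).
      - change (@eq R (L * norm (y 0) * RInt g 0 tau)
                      (L * RInt g 0 tau * norm (y 0))). ring. }
  apply (norm_RInt_le (fun s => F (T (tau - s) (phi (y s))))
           (fun s => (L * norm (y 0)) * g s) 0 tau); [lra| | |].
  - intros s Hr.
    apply Rle_trans with (1 := op_norm_bound _ (phi (y s)) (gain_linear (tau - s) ltac:(lra))).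
    fold (gain (tau - s)). pose proof (gain_ge0 (tau - s) ltac:(lra)).
    apply Rle_trans with (gain (tau - s) *
      (L * (eta Gamma gamma (op_norm B) L eps s * norm (y 0)))).
    + apply Rmult_le_compat_l; [assumption|].
      apply Rle_trans with (1 := phi_bound _).
      apply Rmult_le_compat_l; [assumption|]. apply Hs. lra.
    + right. unfold g. ring.
  - apply (RInt_correct (V := W)), ex_RInt_linear; assumption.
  - apply (RInt_correct (V := R_CompleteNormedModule)).
    exact (ex_RInt_scal (V := R_NormedModule) g 0 tau (L * norm (y 0)) Hg).
Qed.

End Trigger.

(** * One sampling interval *)

Section SamplingInterval.

Context {V W : CompleteNormedModule R_AbsRing}.
Context (T S : R -> V -> V) (HT : semigroup T) (HS : semigroup S).
Context (B : W -> V) (F : V -> W) (HB : is_linear B) (HF : is_linear F).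
Context (HTS : forall x y, right_deriv T x y ->
  exists b, right_deriv T x b /\ right_deriv S x (plus b (B (F x)))).
Context (HFT : forall e, 0 < e -> exists d, 0 < d /\ forall h, 0 < h < d ->
  forall x : V, norm (F (minus (T h x) x)) <= e * norm x).
Context (Gamma gamma L eps : R).
Context (HGamma : 1 <= Gamma) (Hgamma : 0 < gamma) (HL : 0 <= L) (Heps : 0 < eps).
Context (Hstable : forall t (x : V), 0 <= t ->
  norm (S t x) <= Gamma * exp (- gamma * t) * norm x).
Context (phi : V -> V).
Context (phi_zero : phi zero = zero).
Context (phi_lip : forall x y : V, norm (minus (phi x) (phi y)) <= L * norm (minus x y)).
Context (y : R -> V) (a : R) (Hyc : forall s, continuous y s).
Context (Hy : forall t, 0 <= t <= a ->
  y t = plus (T t (y 0))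
    (RInt (fun s => T (t - s) (plus (B (F (y 0))) (phi (y s)))) 0 t)).

Let b := op_norm B.
Let N := adapted_norm S gamma.

Lemma forcing_bound s :
  norm (minus (plus (B (F (y 0))) (phi (y s))) (B (F (y s))))
  <= b * norm (F (minus (y 0) (y s))) + L * norm (y s).
Proof.
  eapply Rle_trans; [apply (norm_split_plus _
    (B (F (minus (y 0) (y s)))) (phi (y s)))|].
  - rewrite (lin_minus F), (lin_minus B) by assumption. vec_in V.
  - apply Rplus_le_compat.
    + now apply op_norm_bound.
    + now apply phi_bound.
Qed.

(** The bound on the input error may depend on the current state through [K]:
    this covers both the threshold of the triggering rule ([K = 0]) and the
    crude bound by the state itself when the interval starts at zero. *)
Lemma state_comparison (K c tau : R) (v dv : R -> R) :
  0 <= tau <= a ->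
  (forall s, is_derive v s (dv s)) ->
  N (y 0) <= v 0 ->
  (forall s, 0 <= s < tau ->
     Gamma * (b * norm (F (minus (y 0) (y s)))) <= K * N (y s) + c) ->
  (forall s, 0 <= s < tau -> (K + Gamma * L - gamma) * v s + c <= dv s) ->
  forall s, 0 <= s <= tau -> N (y s) <= v s.
Proof.
  intros Htau Hder H0 Herr Hv.
  apply (dini_comparison (fun s => N (y s)) v dv (K + Gamma * L - gamma) c);
    [lra| |assumption|assumption| |assumption].
  - intros s _. apply (cont_at_norm y N Gamma); [|apply Hyc].
    exact (adapted_norm_lipschitz S HS Gamma gamma Hstable).
  - intros s Hs e He.
    destruct (adapted_norm_dini S HS Gamma gamma HGamma Hgamma Hstable T HT
      (fun x => B (F x)) (is_linear_comp F B HF HB) HTS y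
      (fun s => plus (B (F (y 0))) (phi (y s))) a) with (s := s)
      (m := b * norm (F (minus (y 0) (y s))) + L * norm (y s)) (e := e)
      as [d [Hd Hq]].
    + intros r. apply (continuous_plus (fun _ => B (F (y 0)))).
      * apply continuous_const.
      * now apply (phi_continuous L).
    + exact Hy.
    + lra.
    + apply forcing_bound.
    + exact He.
    + exists d. split; [assumption|]. intros h Hh.
      apply Rle_trans with (1 := Hq h Hh). fold N.
      apply Rplus_le_compat_l, Rmult_le_compat_l; [lra|].
      apply Rplus_le_compat_r.
      pose proof (norm_le_adapted S HS Gamma gamma Hstable (y s)) as Hn.
      fold N in Hn. specialize (Herr s Hs).
      assert (Gamma * L * norm (y s) <= Gamma * L * N (y s)).
      { apply Rmult_le_compat_l; [apply Rmult_le_pos; lra|exact Hn]. }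
      lra.
Qed.

Lemma state_le_eta tau : 0 <= tau <= a ->
  (forall s, 0 <= s < tau -> norm (F (minus (y 0) (y s))) <= eps * norm (y 0)) ->
  forall s, 0 <= s <= tau ->
    norm (y s) <= eta Gamma gamma b L eps s * norm (y 0).
Proof.
  intros Htau Herr s Hs. pose proof (op_norm_ge0 B HB) as Hb. fold b in Hb.
  pose proof (norm_ge_0 (y 0)) as Hn0.
  apply Rle_trans with (1 := norm_le_adapted S HS Gamma gamma Hstable (y s)).
  fold N. revert s Hs.
  apply (state_comparison 0 (Gamma * b * eps * norm (y 0)) tau
    (fun s => eta Gamma gamma b L eps s * norm (y 0))
    (fun s => (Gamma * L * eta Gamma gamma b L eps s
      - gamma * (Gamma * exp (Gamma * L * s)
          * ((1 - eps * b / gamma) * exp (- gamma * s)))) * norm (y 0)) Htau).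
  - intros s. apply (is_derive_scal_l (V := R_NormedModule)
      (eta Gamma gamma b L eps)). apply eta_derive.
  - rewrite eta_0. apply adapted_le_norm; assumption.
  - intros s Hs. specialize (Herr s Hs).
    apply (Rmult_le_compat_l (Gamma * b)) in Herr; [|apply Rmult_le_pos; lra].
    lra.
  - intros s Hs.
    pose proof (eta_supersolution Gamma gamma b L eps HGamma Hgamma Hb HL Heps s
      ltac:(lra)) as Hsup.
    apply (Rmult_le_compat_r (norm (y 0))) in Hsup; [|assumption]. lra.
Qed.

Lemma input_error_cont s : cont_at (fun r => norm (F (minus (y 0) (y r)))) s.
Proof.
  apply (cont_at_norm y (fun z => norm (F (minus (y 0) z))) (op_norm F) s);
    [|apply Hyc].
  intros u w. apply Rle_trans with (1 := norm_triangle_inv _ _).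
  match goal with |- norm ?z <= _ => replace z with (F (minus w u)) end.
  - rewrite (norm_minus_sym u w). now apply op_norm_bound.
  - rewrite !(lin_minus F) by assumption. vec_in W.
Qed.

(** The triggering rule guarantees that the input error stays below the
    threshold, by a bootstrap: as long as it does, [eta] dominates the state,
    hence the triggering function, which lies strictly below the threshold,
    dominates the error. *)
Lemma input_error_le_threshold :
  0 <= a -> y 0 <> zero ->
  (forall tau, 0 < tau < a ->
     real_alpha T B F Gamma gamma L eps (y 0) tau < eps * norm (y 0)) ->
  forall s, 0 <= s <= a -> norm (F (minus (y 0) (y s))) <= eps * norm (y 0).
Proof.
  intros Ha Hy0 Htrig.
  assert (Hn : 0 < eps * norm (y 0)).
  { apply Rmult_lt_0_compat; [assumption|]. pose proof (norm_ge_0 (y 0)).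
    destruct (Req_dec (norm (y 0)) 0) as [Hz|Hz]; [|lra].
    now apply (@norm_eq_zero R_AbsRing V) in Hz. }
  assert (H0 : norm (F (minus (y 0) (y 0))) = 0).
  { rewrite (lin_minus F) by assumption. apply norm_minus_self. }
  apply real_induction; [assumption|rewrite H0; lra| |].
  - intros s Hs HP.
    assert (Hlt : norm (F (minus (y 0) (y s))) < eps * norm (y 0)).
    { destruct (Req_dec s 0) as [->|Hs0]; [rewrite H0; assumption|].
      apply Rle_lt_trans with (2 := Htrig s ltac:(lra)).
      apply (input_error_le_alpha T HT B F HF HFT Gamma gamma L eps HL phi phi_zero
        phi_lip y a Hyc Hy s ltac:(lra)).
      apply state_le_eta; [lra|]. intros r Hr. apply HP. lra. }
    destruct (input_error_cont s (eps * norm (y 0) - norm (F (minus (y 0) (y s)))))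
      as [d [Hd Hq]]; [lra|].
    exists d. split; [assumption|]. intros r Hr _.
    specialize (Hq r). rewrite Rabs_right in Hq by lra.
    specialize (Hq ltac:(lra)). apply Rabs_def2 in Hq. lra.
  - intros s Hs HP. apply Rnot_lt_le. intros Hlt.
    destruct (input_error_cont s (norm (F (minus (y 0) (y s))) - eps * norm (y 0)))
      as [d [Hd Hq]]; [lra|].
    set (r := Rmax 0 (s - d / 2)).
    assert (Hr : 0 <= r < s /\ s - r < d).
    { unfold r, Rmax. destruct (Rle_dec 0 (s - d / 2)); lra. }
    specialize (Hq r). rewrite Rabs_left in Hq by lra.
    specialize (Hq ltac:(lra)). apply Rabs_def2 in Hq.
    specialize (HP r ltac:(lra)). lra.
Qed.

(** The zero state never triggers, so the error bound of the triggering rule is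
    replaced by the one that [y 0 = zero] gives: the input error is at most
    [op_norm F] times the norm of the state. *)
Lemma zero_state_stays : y 0 = zero -> forall s, 0 <= s <= a -> N (y s) <= 0.
Proof.
  intros Hy0 s Hs.
  apply (state_comparison (Gamma * (b * op_norm F)) 0 a (fun _ => 0) (fun _ => 0));
    try lra.
  - intros r. auto_derive; [easy|ring].
  - apply Rle_trans with (1 := adapted_le_norm S Gamma gamma Hstable (y 0)).
    rewrite Hy0, norm_0. lra.
  - intros r Hr.
    pose proof (op_norm_ge0 B HB) as Hb. fold b in Hb.
    pose proof (op_norm_bound F (minus (y 0) (y r)) HF) as HFb.
    replace (norm (minus (y 0) (y r))) with (norm (y r)) in HFb.
    2:{ rewrite Hy0, <- (norm_neg (y r)). f_equal. vec_in V. }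
    pose proof (norm_le_adapted S HS Gamma gamma Hstable (y r)) as Hn. fold N in Hn.
    pose proof (op_norm_ge0 F HF).
    assert (op_norm F * norm (y r) <= op_norm F * N (y r))
      by now apply Rmult_le_compat_l.
    assert (Gamma * b * norm (F (minus (y 0) (y r)))
            <= Gamma * b * (op_norm F * N (y r))).
    { apply Rmult_le_compat_l; [apply Rmult_le_pos; lra|lra]. }
    lra.
  - intros r Hr. lra.
Qed.

(** With the error below the threshold the adapted norm satisfies
    [N' <= (Gamma * L - gamma) * N + Gamma * b * eps * N (y 0)], and the
    condition on [gamma0] says that [exp (- gamma0 * s) * N (y 0)] is a
    supersolution up to time [tau_max]. *)
Lemma interval_decay (tau_max gamma0 : R) :
  0 <= a <= tau_max -> 0 <= gamma0 ->
  Gamma * b * eps <= (gamma - Gamma * L - gamma0) * exp (- gamma0 * tau_max) ->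
  (forall tau, 0 < tau < a -> y 0 <> zero ->
     real_alpha T B F Gamma gamma L eps (y 0) tau < eps * norm (y 0)) ->
  forall s, 0 <= s <= a -> N (y s) <= exp (- gamma0 * s) * N (y 0).
Proof.
  intros Ha Hg0 Hrate Htrig.
  pose proof (op_norm_ge0 B HB) as Hb. fold b in Hb.
  pose proof (norm_le_adapted S HS Gamma gamma Hstable (y 0)) as Hn. fold N in Hn.
  pose proof (norm_ge_0 (y 0)) as Hn0.
  destruct (classic (y 0 = zero)) as [Hz|Hnz].
  { intros s Hs. apply Rle_trans with (1 := zero_state_stays Hz s Hs).
    apply Rmult_le_pos; [apply Rlt_le, exp_pos|lra]. }
  pose proof (input_error_le_threshold ltac:(lra) Hnz
    (fun tau Htau => Htrig tau Htau Hnz)) as Herr.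
  apply (state_comparison 0 (Gamma * b * eps * N (y 0)) a
    (fun s => exp (- gamma0 * s) * N (y 0))
    (fun s => (- gamma0 * exp (- gamma0 * s)) * N (y 0)) ltac:(lra)).
  - intros s. auto_derive; [easy|ring].
  - rewrite Rmult_0_r, exp_0. lra.
  - intros s Hs. specialize (Herr s ltac:(lra)).
    assert (norm (F (minus (y 0) (y s))) <= eps * N (y 0)).
    { apply Rle_trans with (1 := Herr). apply Rmult_le_compat_l; lra. }
    assert (Gamma * b * norm (F (minus (y 0) (y s))) <= Gamma * b * (eps * N (y 0))).
    { apply Rmult_le_compat_l; [apply Rmult_le_pos; lra|assumption]. }
    lra.
  - intros s Hs.
    assert (Hexp : exp (- gamma0 * tau_max) <= exp (- gamma0 * s)).
    { apply exp_le_compat. nra. }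
    pose proof (exp_pos (- gamma0 * tau_max)) as Hpos.
    assert (0 <= Gamma * b * eps)
      by (apply Rmult_le_pos; [apply Rmult_le_pos|]; lra).
    assert (Hd : 0 <= gamma - Gamma * L - gamma0).
    { apply Rnot_lt_le. intros Hlt. nra. }
    assert (Hs1 : Gamma * b * eps <= (gamma - Gamma * L - gamma0) * exp (- gamma0 * s)).
    { apply Rle_trans with (1 := Hrate). now apply Rmult_le_compat_l. }
    apply (Rmult_le_compat_r (N (y 0))) in Hs1; lra.
Qed.

End SamplingInterval.

(** * The sampled-data closed loop *)

Section ClosedLoop.

Context {V W : CompleteNormedModule R_AbsRing}.
Context (T S : R -> V -> V) (HT : semigroup T) (HS : semigroup S).
Context (B : W -> V) (F : V -> W) (HB : is_linear B) (HF : is_linear F).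
Context (HTS : forall x y, right_deriv T x y ->
  exists b, right_deriv T x b /\ right_deriv S x (plus b (B (F x)))).
Context (HFT : forall e, 0 < e -> exists d, 0 < d /\ forall h, 0 < h < d ->
  forall x : V, norm (F (minus (T h x) x)) <= e * norm x).
Context (Gamma gamma L eps : R).
Context (HGamma : 1 <= Gamma) (Hgamma : 0 < gamma) (HL : 0 <= L) (Heps : 0 < eps).
Context (Hstable : forall t (x : V), 0 <= t ->
  norm (S t x) <= Gamma * exp (- gamma * t) * norm x).
Context (phi : V -> V).
Context (phi_zero : phi zero = zero).
Context (phi_lip : forall x y : V, norm (minus (phi x) (phi y)) <= L * norm (minus x y)).

Context (tau_max gamma0 : R) (Hgamma0 : 0 <= gamma0).
Context (Hrate : Gamma * op_norm B * eps <=
  (gamma - Gamma * L - gamma0) * exp (- gamma0 * tau_max)).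

Context (t : nat -> R) (x : R -> V) (theta : R).
Context (Htheta : 0 < theta).
Context (Ht0 : t 0%nat = 0).
Context (Hstep : forall n, theta <= t (Datatypes.S n) - t n <= tau_max).
Context (Htrig : forall n tau, 0 < tau < t (Datatypes.S n) - t n -> x (t n) <> zero ->
  real_alpha T B F Gamma gamma L eps (x (t n)) tau < eps * norm (x (t n))).
Context (Hxc : forall p e, 0 < e -> 0 <= p -> (exists n, p <= t n) ->
  exists d, 0 < d /\ forall q, Rabs (q - p) < d -> 0 <= q -> (exists n, q <= t n) ->
    norm (minus (x q) (x p)) < e).
Context (Hx : forall n tau, 0 < tau <= t (Datatypes.S n) - t n ->
  x (t n + tau) = plus (T tau (x (t n)))
    (RInt (fun s => T (tau - s) (plus (B (F (x (t n)))) (phi (x (t n + s))))) 0 tau)).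

Lemma times_grow n : INR n * theta <= t n.
Proof.
  induction n as [|n IH]; [rewrite Ht0; simpl; lra|].
  rewrite S_INR. specialize (Hstep n). lra.
Qed.

Lemma times_ge0 n : 0 <= t n.
Proof.
  apply Rle_trans with (2 := times_grow n).
  apply Rmult_le_pos; [apply pos_INR|lra].
Qed.

(** The trajectory on a sampling interval, continued by constants so that it
    is continuous on the whole line. *)
Let piece n s := x (t n + Rmax 0 (Rmin s (t (Datatypes.S n) - t n))).

Lemma piece_in n s : 0 <= s <= t (Datatypes.S n) - t n -> piece n s = x (t n + s).
Proof. intros Hs. unfold piece. now rewrite Rmin_left, Rmax_right by lra. Qed.

Lemma piece_continuous n s : continuous (piece n) s.
Proof.
  apply continuous_norm_iff. intros e He. unfold piece.
  set (l := t (Datatypes.S n) - t n). specialize (Hstep n) as Hl. fold l in Hl.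
  pose proof (times_ge0 n) as Htn.
  assert (Hin : forall r, 0 <= Rmax 0 (Rmin r l) <= l).
  { intros r. split; [apply Rmax_l|]. apply Rmax_lub; [lra|apply Rmin_r]. }
  assert (Hdom : forall r, exists m, t n + Rmax 0 (Rmin r l) <= t m).
  { intros r. exists (Datatypes.S n). specialize (Hin r). unfold l in *. lra. }
  pose proof (Hin s) as Hins.
  destruct (Hxc (t n + Rmax 0 (Rmin s l)) e He ltac:(lra) (Hdom s)) as [d [Hd Hq]].
  exists d. split; [assumption|]. intros r Hr. pose proof (Hin r).
  apply Hq; [|lra|apply Hdom].
  apply Rle_lt_trans with (2 := Hr).
  replace (t n + Rmax 0 (Rmin r l) - (t n + Rmax 0 (Rmin s l)))
    with (Rmax 0 (Rmin r l) - Rmax 0 (Rmin s l)) by ring.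
  apply Rabs_le.
  pose proof (Rle_abs (r - s)). pose proof (Rle_abs (- (r - s))) as Hopp.
  rewrite Rabs_Ropp in Hopp.
  unfold Rmin. destruct (Rle_dec r l), (Rle_dec s l); unfold Rmax;
    repeat destruct (Rle_dec 0 _); lra.
Qed.

Lemma piece_mild n tau : 0 <= tau <= t (Datatypes.S n) - t n ->
  piece n tau = plus (T tau (piece n 0))
    (RInt (fun s => T (tau - s) (plus (B (F (piece n 0))) (phi (piece n s)))) 0 tau).
Proof.
  intros Htau. specialize (Hstep n).
  rewrite !piece_in, Rplus_0_r by lra.
  destruct (Req_dec tau 0) as [->|Hne].
  - rewrite (RInt_point (V := V)), (sg_zero T HT), Rplus_0_r. vec_in V.
  - rewrite Hx by lra. f_equal. apply (RInt_ext (V := V)).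
    rewrite Rmin_left, Rmax_right by lra. intros s Hs.
    now rewrite piece_in by lra.
Qed.

Let N := adapted_norm S gamma.

Lemma piece_decay n s : 0 <= s <= t (Datatypes.S n) - t n ->
  N (x (t n + s)) <= exp (- gamma0 * s) * N (x (t n)).
Proof.
  intros Hs. pose proof (Hstep n) as Hl.
  pose proof (interval_decay T S HT HS B F HB HF HTS HFT Gamma gamma L eps HGamma
    Hgamma HL Heps Hstable phi phi_zero phi_lip (piece n)
    (t (Datatypes.S n) - t n) (piece_continuous n) (piece_mild n)
    tau_max gamma0 ltac:(lra) Hgamma0 Hrate) as Hdecay.
  assert (H0 : piece n 0 = x (t n)) by (rewrite piece_in, Rplus_0_r by lra; easy).
  rewrite H0 in Hdecay. specialize (Hdecay (Htrig n) s Hs).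
  now rewrite piece_in in Hdecay by assumption.
Qed.

Lemma sample_decay n : N (x (t n)) <= exp (- gamma0 * t n) * N (x 0).
Proof.
  induction n as [|n IH]; [rewrite Ht0, Rmult_0_r, exp_0; lra|].
  pose proof (Hstep n) as Hl.
  pose proof (piece_decay n (t (Datatypes.S n) - t n) ltac:(lra)) as Hp.
  replace (t n + (t (Datatypes.S n) - t n)) with (t (Datatypes.S n)) in Hp by ring.
  apply Rle_trans with (1 := Hp).
  replace (- gamma0 * t (Datatypes.S n))
    with (- gamma0 * (t (Datatypes.S n) - t n) + - gamma0 * t n) by ring.
  rewrite exp_plus, Rmult_assoc. apply Rmult_le_compat_l; [|exact IH].
  apply Rlt_le, exp_pos.
Qed.

Lemma sampling_interval_exists s : 0 <= s -> exists n, t n <= s <= t (Datatypes.S n).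
Proof.
  intros Hs. apply NNPP. intros Hno.
  assert (Hall : forall n, t n <= s).
  { induction n as [|n IH]; [rewrite Ht0; assumption|].
    apply Rnot_lt_le. intros Hlt. apply Hno. exists n. lra. }
  destruct (INR_unbounded (s / theta)) as [n Hn].
  specialize (Hall n). pose proof (times_grow n).
  apply (Rmult_lt_compat_r theta) in Hn; [|assumption].
  replace (s / theta * theta) with s in Hn by (field; lra). lra.
Qed.

Lemma closed_loop_decay s : 0 <= s ->
  norm (x s) <= Gamma * exp (- gamma0 * s) * norm (x 0).
Proof.
  intros Hs. destruct (sampling_interval_exists s Hs) as [n Hn].
  apply Rle_trans with (1 := norm_le_adapted S HS Gamma gamma Hstable (x s)). fold N.
  pose proof (piece_decay n (s - t n) ltac:(lra)) as Hp.
  replace (t n + (s - t n)) with s in Hp by ring.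
  pose proof (sample_decay n) as Hn0.
  pose proof (adapted_le_norm S Gamma gamma Hstable (x 0)) as H0. fold N in H0.
  apply Rle_trans with (exp (- gamma0 * s) * N (x 0)).
  - apply Rle_trans with (1 := Hp).
    replace (- gamma0 * s) with (- gamma0 * (s - t n) + - gamma0 * t n) by ring.
    rewrite exp_plus, Rmult_assoc. apply Rmult_le_compat_l; [|exact Hn0].
    apply Rlt_le, exp_pos.
  - apply (Rmult_le_compat_l (exp (- gamma0 * s))) in H0;
      [lra|apply Rlt_le, exp_pos].
Qed.

End ClosedLoop.

(** * Restriction of scalars *)

Section RealPart.

Context (k : scalar_field).

Definition real_part : scalars k -> R :=
  match k with RealField => fun r => r | ComplexField => fst end.

Lemma real_part_plus (a b : scalars k) :
  real_part (plus a b) = real_part a + real_part b.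
Proof. unfold real_part. now destruct k. Qed.

Lemma real_part_scal (r : R) (a : scalars k) :
  real_part (mult (of_real k r) a) = r * real_part a.
Proof.
  unfold real_part. destruct k; [reflexivity|]. destruct a as [u v].
  simpl. ring.
Qed.

Lemma real_part_conj (a : scalars k) : real_part (conj k a) = real_part a.
Proof. unfold real_part. now destruct k. Qed.

Lemma real_part_of_real (r : R) : real_part (of_real k r) = r.
Proof. unfold real_part. now destruct k. Qed.

(** The real part of a Hermitian product induces the same norm, so that the
    realification of a complex Hilbert space is a real Hilbert space. *)
Lemma inner_product_realify (X : Hilbert k) :
  inner_product (V := realify X) (fun x y : X => real_part (inner x y)).
Proof.
  split.
  - intros x y z.
    change (real_part (inner (plus (x : X) (y : X)) z)
            = real_part (inner x z) + real_part (inner y z)).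
    rewrite inner_plus_l. apply real_part_plus.
  - intros r x y.
    change (real_part (inner (scal (of_real k r) (x : X)) y)
            = r * real_part (inner x y)).
    rewrite inner_scal_l. apply real_part_scal.
  - intros x y. rewrite (inner_conj k X y x). apply real_part_conj.
  - intros x. rewrite inner_norm. apply real_part_of_real.
Qed.

Context {X U : CompleteNormedModule (scalars k)}.

Lemma is_linear_realify (f : X -> U) : is_linear f ->
  is_linear (U := realify X) (V := realify U) f.
Proof.
  intros Hf. split.
  - exact (linear_plus f Hf).
  - intros r x. exact (linear_scal f Hf (of_real k r) x).
  - exact (linear_norm f Hf).
Qed.

Lemma compact_operator_realify (f : X -> U) : compact_operator f ->
  compact_operator (V := realify X) (W := realify U) f.
Proof.
  intros [Hlin Hcomp]. split; [now apply is_linear_realify|exact Hcomp].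
Qed.

End RealPart.

Lemma at_right_0_filterlim {V : CompleteNormedModule R_AbsRing} (f : R -> V) (l : V) :
  filterlim f (at_right 0) (locally l) <->
  forall e, 0 < e -> exists d, 0 < d /\
    forall h, 0 < h < d -> norm (minus (f h) l) < e.
Proof.
  pose proof (filterlim_locally_ball_norm (F := at_right 0) f l) as Hiff.
  assert (Hball : forall h d, 0 < h -> (Rabs (minus h 0) < d <-> h < d)).
  { intros h d Hh. replace (minus h 0) with h by (symmetry; apply Rminus_0_r).
    rewrite Rabs_right by lra. reflexivity. }
  split.
  - intros Hf e He. destruct (proj1 Hiff Hf (mkposreal e He)) as [d Hd].
    exists d. split; [apply cond_pos|]. intros h Hh.
    apply (Hd h); [|lra]. apply (Hball h d); lra.
  - intros Hf. apply (proj2 Hiff). intros e.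
    destruct (Hf e (cond_pos e)) as [d [Hd Hq]]. exists (mkposreal d Hd).
    intros h Hh Hh0. apply Hq. split; [assumption|]. now apply (Hball h d).
Qed.

Lemma right_deriv_filterlim {V : CompleteNormedModule R_AbsRing}
    (T : R -> V -> V) (x y : V) :
  filterlim (fun h => scal (/ h) (minus (T h x) x)) (at_right 0) (locally y) <->
  right_deriv T x y.
Proof.
  pose proof (at_right_0_filterlim
    (fun h => scal (/ h) (minus (T h x) x)) y) as Hiff.
  assert (Hnorm : forall h, 0 < h ->
    norm (minus (minus (T h x) x) (scal h y))
    = h * norm (minus (scal (/ h) (minus (T h x) x)) y)).
  { intros h Hh.
    rewrite <- (norm_scal_pos h) by lra. f_equal. vec_in V. }
  split.
  - intros Hf e He. destruct (proj1 Hiff Hf e He) as [d [Hd Hq]].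
    exists d. split; [assumption|]. intros h Hh. rewrite Hnorm by lra.
    rewrite (Rmult_comm e).
    apply Rmult_le_compat_l; [lra|]. exact (Rlt_le _ _ (Hq h Hh)).
  - intros Hf. apply (proj2 Hiff). intros e He.
    destruct (Hf (e / 2)) as [d [Hd Hq]]; [lra|].
    exists d. split; [assumption|]. intros h Hh. specialize (Hq h Hh).
    rewrite Hnorm in Hq by lra. apply Rmult_lt_reg_l with h; [lra|].
    apply Rle_lt_trans with (1 := Hq). nra.
Qed.

Section Realification.

Context {k : scalar_field} {X U : CompleteNormedModule (scalars k)}.

Lemma C0_semigroup_realify (T : R -> X -> X) : C0_semigroup T ->
  semigroup (V := realify X) T.
Proof.
  intros [Hlin [H0 [Hadd Hcont]]]. split.
  - intros t Ht. apply is_linear_realify. now apply Hlin.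
  - exact H0.
  - intros s t x Hs Ht. now apply Hadd.
  - intros x. apply (at_right_0_filterlim (V := realify X)). apply Hcont.
Qed.

Lemma generates_right_deriv (D : X -> Prop) (A : X -> X) (T : R -> X -> X) (x : X) :
  generates D A T -> D x -> right_deriv (V := realify X) T x (A x).
Proof.
  intros [HD _] Hx. apply (right_deriv_filterlim (V := realify X)).
  exact (HD x Hx).
Qed.

Lemma generates_domain (D : X -> Prop) (A : X -> X) (T : R -> X -> X) (x y : X) :
  generates D A T -> right_deriv (V := realify X) T x y -> D x.
Proof.
  intros [_ HD] Hx. apply (HD x y).
  exact (proj2 (right_deriv_filterlim (V := realify X) T x y) Hx).
Qed.

Lemma continuous_on_realify (D : R -> Prop) (x : R -> X) p e :
  continuous_on D x -> 0 < e -> D p ->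
  exists d, 0 < d /\ forall q, Rabs (q - p) < d -> D q ->
    norm (minus (x q) (x p)) < e.
Proof.
  intros Hx He Hp. specialize (Hx p Hp).
  pose proof (proj1 (filterlim_locally_ball_norm (U := X)
    (F := within D (locally p)) x (x p)) Hx (mkposreal e He)) as [d Hd].
  exists d. split; [apply cond_pos|]. intros q Hq HDq. exact (Hd q Hq HDq).
Qed.

End Realification.

(** * Transmission times and the decay rate *)

(** The triggering function may fail to be below the threshold at the next
    transmission time itself: the infimum controls it strictly before. *)
Lemma self_triggered_step {k : scalar_field} {X U : CompleteNormedModule (scalars k)}
    (T : R -> X -> X) (B : U -> X) (F : X -> U)
    (Gamma gamma L eps tau_max theta : R) (x : R -> X) (t : nat -> R) (n : nat) :
  (forall (xi : X) tau, 0 < tau < theta -> xi <> zero ->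
     alpha T B F Gamma gamma L eps xi tau < eps * norm xi) ->
  self_triggered_times T B F Gamma gamma L eps tau_max x t ->
  Rmin theta tau_max <= t (Datatypes.S n) - t n <= tau_max /\
  forall tau, 0 < tau < t (Datatypes.S n) - t n -> x (t n) <> zero ->
    alpha T B F Gamma gamma L eps (x (t n)) tau < eps * norm (x (t n)).
Proof.
  intros Htheta [_ Ht]. specialize (Ht n).
  unfold trigger_time in Ht.
  set (P := fun tau => 0 < tau /\ x (t n) <> zero /\
              alpha T B F Gamma gamma L eps (x (t n)) tau >= eps * norm (x (t n))) in Ht.
  destruct (Glb_Rbar_correct P) as [Hlb Hglb].
  assert (Hmin : Rbar_le theta (Glb_Rbar P)).
  { apply Hglb. intros tau [Htau [Hne Hal]]. simpl.
    apply Rnot_lt_le. intros Hlt.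
    pose proof (Htheta (x (t n)) tau (Logic.conj Htau Hlt) Hne). lra. }
  assert (Htrig : forall tau, 0 < tau -> Rbar_lt tau (Glb_Rbar P) ->
            x (t n) <> zero ->
            alpha T B F Gamma gamma L eps (x (t n)) tau < eps * norm (x (t n))).
  { intros tau Htau Hlt Hne. apply Rnot_le_lt. intros Hge.
    apply (Rbar_lt_not_le _ _ Hlt), Hlb. repeat split; (assumption || lra). }
  pose proof (Rmin_l theta tau_max). pose proof (Rmin_r theta tau_max).
  destruct (Glb_Rbar P) as [r| |]; simpl in Hmin, Ht, Htrig; [| |easy].
  - apply (f_equal real) in Ht. simpl in Ht.
    pose proof (Rmin_l tau_max r). pose proof (Rmin_r tau_max r).
    assert (Rmin theta tau_max <= Rmin tau_max r) by (apply Rmin_glb; lra).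
    split; [lra|]. intros tau Htau. apply Htrig; lra.
  - apply (f_equal real) in Ht. simpl in Ht.
    split; [lra|]. intros tau Htau. apply Htrig; [lra|exact I].
Qed.

Lemma Inf_seq_ge (u : nat -> R) (r : R) : (forall n, r <= u n) ->
  Rbar_le r (Inf_seq (fun n => u n)).
Proof.
  intros Hu. pose proof (Inf_seq_correct (fun n => Finite (u n))) as H.
  destruct (Inf_seq (fun n => Finite (u n))) as [l| |]; simpl in *; [|exact I|].
  - apply Rnot_lt_le. intros Hlt.
    assert (Hpos : 0 < r - l) by lra.
    destruct (H (mkposreal _ Hpos)) as [_ [n Hn]]. simpl in Hn.
    specialize (Hu n). lra.
  - destruct (H r) as [n Hn]. specialize (Hu n). lra.
Qed.

Lemma decay_rate_exists (g m tau : R) : 0 <= m < g -> 0 < tau ->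
  exists r, 0 < r /\ m <= (g - r) * exp (- r * tau).
Proof.
  intros Hm Htau. set (r := (g - m) / (1 + tau * g)).
  assert (Hden : 1 <= 1 + tau * g) by nra.
  assert (Hr : 0 < r) by (apply Rdiv_lt_0_compat; lra).
  assert (Hrd : r * (1 + tau * g) = g - m) by (unfold r; field; lra).
  exists r. split; [assumption|].
  (* [exp (- u) >= 1 - u], and [r] solves [(g - r) * (1 - r * tau) = m] up to
     the positive term [r ^ 2 * tau] *)
  pose proof (exp_ineq1_le (- r * tau)) as Hexp.
  assert (Hgr : 0 <= g - r) by nra.
  apply Rle_trans with ((g - r) * (1 + - r * tau)).
  - assert (0 <= r * r * tau) by (apply Rmult_le_pos; nra). nra.
  - now apply Rmult_le_compat_l.
Qed.

Theorem theorem2p7 (k : scalar_field) (X U : Hilbert k)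
    (T : R -> X -> X) (D : X -> Prop) (A : X -> X)
    (B : U -> X) (F : X -> U) (phi : X -> X)
    (TBF : R -> X -> X) (Gamma gamma L : R)
    (T_semigroup : C0_semigroup T)
    (A_generates_T : generates D A T)
    (B_bounded : is_linear B)
    (F_compact : compact_operator F)
    (phi_zero : phi zero = zero)
    (L_ge0 : 0 <= L)
    (phi_lipschitz : forall xi1 xi2 : X,
       norm (minus (phi xi1) (phi xi2)) <= L * norm (minus xi1 xi2))
    (TBF_semigroup : C0_semigroup TBF)
    (ABF_generates_TBF : generates D (fun x => plus (A x) (B (F x))) TBF)
    (Gamma_ge1 : 1 <= Gamma)
    (gamma_gt0 : 0 < gamma)
    (TBF_stable : forall t, 0 <= t ->
       op_norm (TBF t) <= Gamma * exp (- gamma * t)) :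
  (forall eps tau_max : R, 0 < eps -> 0 < tau_max ->
     exists theta : R, 0 < theta /\
       forall (x0 : X) (t : nat -> R) (x : R -> X),
         self_triggered_solution T B F phi Gamma gamma L eps tau_max x0 t x ->
         Rbar_le theta (Inf_seq (fun n => t (S n) - t n)))
  /\
  (forall eps tau_max : R, 0 < eps -> 0 < tau_max ->
     Rmax (Gamma / gamma * L) (varpi Gamma gamma (op_norm B) L eps tau_max)
       + Gamma * op_norm B / gamma * eps < 1 ->
     exponentially_stable (fun x0 x => exists t : nat -> R,
       self_triggered_solution T B F phi Gamma gamma L eps tau_max x0 t x)).
Proof.
  pose proof (C0_semigroup_realify T T_semigroup) as HT.
  pose proof (C0_semigroup_realify TBF TBF_semigroup) as HS.
  pose proof (is_linear_realify k B B_bounded) as HB.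
  pose proof (compact_operator_realify k F F_compact) as HFc.
  pose proof (proj1 HFc) as HF.
  pose proof (compact_semigroup_norm_continuous _ _ (inner_product_realify k X)
    (inner_product_realify k U) F HFc T HT) as HFT.
  pose proof (op_norm_ge0 (V := realify U) (W := realify X) B HB) as Hb.
  assert (Htheta : forall eps, 0 < eps -> exists theta, 0 < theta /\
    forall (xi : X) tau, 0 < tau < theta -> xi <> zero ->
      alpha T B F Gamma gamma L eps xi tau < eps * norm xi).
  { intros eps Heps.
    exact (real_alpha_small (V := realify X) (W := realify U) T HT B F HB HF HFT
      Gamma gamma L eps Gamma_ge1 gamma_gt0 L_ge0 Heps). }
  split.
  - intros eps tau_max Heps Htau.
    destruct (Htheta eps Heps) as [theta [Hth Hal]].
    exists (Rmin theta tau_max). split; [now apply Rmin_pos|].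
    intros x0 t x [Htimes _]. apply (Inf_seq_ge (fun n => t (S n) - t n)).
    intros n.
    apply (self_triggered_step T B F Gamma gamma L eps tau_max theta x t n Hal Htimes).
  - intros eps tau_max Heps Htau Hsmall.
    assert (Hgap : 0 <= Gamma * op_norm B * eps < gamma - Gamma * L).
    { split; [apply Rmult_le_pos; [apply Rmult_le_pos|]; (exact Hb || lra)|].
      pose proof (Rmax_l (Gamma / gamma * L)
        (varpi Gamma gamma (op_norm B) L eps tau_max)).
      assert (Hlt : Gamma / gamma * L + Gamma * op_norm B / gamma * eps < 1) by lra.
      apply (Rmult_lt_compat_r gamma) in Hlt; [|assumption].
      replace ((Gamma / gamma * L + Gamma * op_norm B / gamma * eps) * gamma)
        with (Gamma * L + Gamma * op_norm B * eps) in Hlt by (field; lra).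
      lra. }
    destruct (decay_rate_exists _ _ tau_max Hgap Htau) as [gamma0 [Hg0 Hrate]].
    destruct (Htheta eps Heps) as [theta [Hth Hal]].
    exists Gamma, gamma0. split; [assumption|]. split; [assumption|].
    intros x0 x [t [Htimes [Hx0 [Hcont Heq]]]] s Hs.
    pose proof (fun n => self_triggered_step T B F Gamma gamma L eps tau_max theta
      x t n Hal Htimes) as Hstep.
    rewrite <- Hx0.
    apply (closed_loop_decay (V := realify X) (W := realify U) T TBF HT HS B F HB HF)
      with (gamma := gamma) (L := L) (eps := eps) (phi := phi) (tau_max := tau_max)
        (t := t) (theta := Rmin theta tau_max); try assumption.
    + intros y z Hyz.
      pose proof (generates_domain D A T y z A_generates_T Hyz) as HD.
      exists (A y). split.
      * exact (generates_right_deriv D A T y A_generates_T HD).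
      * exact (generates_right_deriv D _ TBF y ABF_generates_TBF HD).
    + intros r z Hr.
      apply Rle_trans with
        (1 := op_norm_bound (V := realify X) (W := realify X) (TBF r) z
                (sg_linear (V := realify X) TBF HS r Hr)).
      apply Rmult_le_compat_r; [apply (norm_ge_0 (V := realify X))|].
      now apply TBF_stable.
    + lra.
    + now apply Rmin_pos.
    + apply Htimes.
    + intros n. apply Hstep.
    + intros n tau Htn Hne. exact (proj2 (Hstep n) tau Htn Hne).
    + intros p e He Hp Hn.
      destruct (continuous_on_realify _ x p e Hcont He (Logic.conj Hp Hn))
        as [d [Hd Hq]].
      exists d. split; [assumption|]. intros q Hqp Hq0 Hqn.
      exact (Hq q Hqp (Logic.conj Hq0 Hqn)).
Qed.
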